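(* The $C^*$-algebra $D_{-1}$ is isomorphic to the $C^*$-algebra $$A_1=\{f\in C(D^2\to M_2(\mathbb{C}))\ :\ V^*(\phi)f(e^{i\phi})V(\phi)\in\mathbb{C}\oplus\mathbb{C}\ \text{ for all }\phi\in[0,2\pi]\},$$ where $D^2=\{z\in\mathbb{C}: |z|\le 1\}$ and $$V(\phi)=\frac{1}{\sqrt2}\begin{pmatrix} e^{i\phi/2} & -e^{i\phi/2}\\ 1&1\end{pmatrix}.$$
   Context: $D_{-1}$ (the ''non-commutative circle'', i.e. the quantum disk $a^*a-qaa^*=1-q$ at $q=-1$, up to rescaling the generator) is the universal enveloping $C^*$-algebra of the unital $*$-algebra $\mathbb{C}\langle a,a^*\mid a^*a+aa^*=1\rangle$. The enveloping $C^*$-algebra of a $*$-algebra $\mathcal A$ is a $C^*$-algebra $A$ with a $*$-homomorphism $\rho:\mathcal A\to A$ such that every irreducible representation of $\mathcal A$ by bounded operators factors uniquely through $\rho$ as an irreducible representation of $A$ (equivalently, the universal $C^*$-algebra of $\mathcal{A}$). $C(X\to M_n(\mathbb{C}))$ is the $C^*$-algebra of continuous $M_n(\mathbb C)$-valued functions on a compact space $X$, with pointwise operations. $\mathbb{C}\oplus\mathbb{C}\subset M_2(\mathbb{C})$ denotes the diagonal matrices. *)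

(* Defs.v *)
From HB Require Import structures.
From mathcomp Require Import all_boot all_order all_algebra.
From mathcomp Require Import generic_quotient spectral complex.
From mathcomp Require Import all_classical all_reals all_analysis.

Set Implicit Arguments.
Unset Strict Implicit.
Unset Printing Implicit Defensive.

Import Order.TTheory GRing.Theory Num.Theory.
Import numFieldNormedType.Exports.

Local Open Scope classical_set_scope.
Local Open Scope ring_scope.

(* The complex numbers are R[i] for R : realType.  The library puts no topology
   on R[i]; this is the one given by the modulus. *)
HB.instance Definition _ (R : realType) := NormedModule.copy R[i] R[i]^o.

HB.mixin Record hasStar (C : numClosedFieldType) A & GRing.Algebra C A := {
  star : A -> A;
  starK : involutive star;
  starD : {morph star : x y / x + y};
  starZ : forall (c : C) (x : A), star (c *: x) = c^* *: star x;
  starM : forall x y : A, star (x * y) = star y * star x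
}.

#[short(type="starAlgType")]
HB.structure Definition StarAlgebra (C : numClosedFieldType) :=
  {A of GRing.Algebra C A & hasStar C A}.

(* The norm is a field of the mixin rather than the library's `|_|: a structure
   inheriting from both rings and normed modules over the same field would need
   a join below numDomainType, which the library does not have. *)
HB.mixin Record isCStar (R : realType) A & StarAlgebra R[i] A := {
  cnorm : A -> R;
  cnormD : forall x y : A, cnorm (x + y) <= cnorm x + cnorm y;
  cnormZ : forall (c : R[i]) (x : A), cnorm (c *: x) = complex.Re `|c| * cnorm x;
  cnorm_eq0 : forall x : A, cnorm x = 0 -> x = 0;
  cnorm_complete : forall u : nat -> A,
    (forall e : R, 0 < e -> exists N : nat, forall m n : nat,
      (N <= m)%N -> (N <= n)%N -> cnorm (u m - u n) < e) ->
    exists l : A, (fun n => cnorm (u n - l)) @ \oo --> (0 : R);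
  cnormM : forall x y : A, cnorm (x * y) <= cnorm x * cnorm y;
  cnorm_star : forall x : A, cnorm (star x * x) = cnorm x ^+ 2
}.

#[short(type="cstarAlgType")]
HB.structure Definition CStarAlgebra (R : realType) :=
  {A of StarAlgebra R[i] A & isCStar R A}.

Record star_hom (C : numClosedFieldType) (A B : starAlgType C) (f : A -> B) : Prop := {
  star_hom_linear : linear f;
  star_hom1 : f 1 = 1;
  star_homM : {morph f : x y / x * y};
  star_homS : {morph f : x / star x}
}.

(* Isomorphism of C*-algebras is *-isomorphism: a bijective *-homomorphism
   between C*-algebras is automatically isometric, and a *-algebra has at most
   one C*-norm. *)
Definition star_isomorphic (C : numClosedFieldType) (A B : starAlgType C) : Prop :=
  exists2 f : A -> B, star_hom f & bijective f.

(* C*-algebras here are unital and *-homomorphisms preserve 1, so this is the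
   universal property in the unital category, A being unital. *)
Definition enveloping_cstar (R : realType) (A : starAlgType R[i])
    (D : cstarAlgType R) (rho : A -> D) : Prop :=
  star_hom rho /\
  forall (B : cstarAlgType R) (phi : A -> B), star_hom phi ->
    exists! psi : D -> B, star_hom psi /\ psi \o rho = phi.

Section MatrixStar.
Variables (R : realType) (n : nat).
Local Open Scope sesquilinear_scope.

Definition mxstar (M : 'M[R[i]]_n.+1) : 'M[R[i]]_n.+1 := M^t*.

Lemma mxstarK : involutive mxstar.
Proof. exact: trmxCK. Qed.

Lemma mxstarD : {morph mxstar : M N / M + N}.
Proof. by move=> M N; rewrite /mxstar linearD map_mxD. Qed.

Lemma mxstarZ (c : R[i]) M : mxstar (c *: M) = c^* *: mxstar M.
Proof. by rewrite /mxstar linearZ /= map_mxZ. Qed.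

Lemma mxstarM M N : mxstar (M * N) = mxstar N * mxstar M.
Proof. by rewrite /mxstar trmx_mul map_mxM. Qed.

HB.instance Definition _ := hasStar.Build R[i] 'M[R[i]]_n.+1
  mxstarK mxstarD mxstarZ mxstarM.

End MatrixStar.

(* The unital *-algebra C<a, a* | a* a + a a* = 1>: *-polynomial expressions in
   one generator, modulo the least congruence containing the axioms of unital
   complex *-algebras and the relation. *)
Section Presentation.
Variable R : realType.
Local Open Scope quotient_scope.

Inductive starexp : Type :=
| Sgen
| Sconst of R[i]
| Sadd of starexp & starexp
| Smul of starexp & starexp
| Sstar of starexp.

HB.instance Definition _ := gen_eqMixin starexp.
HB.instance Definition _ := gen_choiceMixin starexp.

Inductive sequiv : starexp -> starexp -> Prop :=
| sequiv_refl x : sequiv x x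
| sequiv_sym x y : sequiv x y -> sequiv y x
| sequiv_trans x y z : sequiv x y -> sequiv y z -> sequiv x z
| sequiv_add x x' y y' :
    sequiv x x' -> sequiv y y' -> sequiv (Sadd x y) (Sadd x' y')
| sequiv_mul x x' y y' :
    sequiv x x' -> sequiv y y' -> sequiv (Smul x y) (Smul x' y')
| sequiv_star x x' : sequiv x x' -> sequiv (Sstar x) (Sstar x')
| sequiv_addA x y z : sequiv (Sadd x (Sadd y z)) (Sadd (Sadd x y) z)
| sequiv_addC x y : sequiv (Sadd x y) (Sadd y x)
| sequiv_add0 x : sequiv (Sadd (Sconst 0) x) x
| sequiv_mul0 x : sequiv (Smul (Sconst 0) x) (Sconst 0)
| sequiv_mulA x y z : sequiv (Smul x (Smul y z)) (Smul (Smul x y) z)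
| sequiv_mul1 x : sequiv (Smul (Sconst 1) x) x
| sequiv_mulDl x y z :
    sequiv (Smul (Sadd x y) z) (Sadd (Smul x z) (Smul y z))
| sequiv_mulDr x y z :
    sequiv (Smul x (Sadd y z)) (Sadd (Smul x y) (Smul x z))
| sequiv_constD c d : sequiv (Sconst (c + d)) (Sadd (Sconst c) (Sconst d))
| sequiv_constM c d : sequiv (Sconst (c * d)) (Smul (Sconst c) (Sconst d))
| sequiv_constC c x : sequiv (Smul (Sconst c) x) (Smul x (Sconst c))
| sequiv_starK x : sequiv (Sstar (Sstar x)) x
| sequiv_starD x y : sequiv (Sstar (Sadd x y)) (Sadd (Sstar x) (Sstar y))
| sequiv_starM x y : sequiv (Sstar (Smul x y)) (Smul (Sstar y) (Sstar x))
| sequiv_starC c : sequiv (Sstar (Sconst c)) (Sconst c^*)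
| sequiv_rel :
    sequiv (Sadd (Smul (Sstar Sgen) Sgen) (Smul Sgen (Sstar Sgen))) (Sconst 1).

Definition sequivb (x y : starexp) : bool := `[< sequiv x y >].

Lemma sequivb_refl : reflexive sequivb.
Proof. by move=> x; apply/asboolP; exact: sequiv_refl. Qed.

Lemma sequivb_sym : symmetric sequivb.
Proof. by move=> x y; apply/asboolP/asboolP => /sequiv_sym. Qed.

Lemma sequivb_trans : transitive sequivb.
Proof.
by move=> y x z /asboolP xy /asboolP yz; apply/asboolP/(sequiv_trans xy yz).
Qed.

Canonical sequivb_equiv :=
  EquivRel sequivb sequivb_refl sequivb_sym sequivb_trans.

Definition ncpoly : Type := {eq_quot sequivb}.

HB.instance Definition _ := Choice.on ncpoly.

Local Notation NC := ncpoly.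

Definition cls (x : starexp) : NC := \pi_({eq_quot sequivb}) x.
Definition rep (u : NC) : starexp := repr (u : {eq_quot sequivb}).

Lemma repK u : cls (rep u) = u.
Proof. exact: reprK. Qed.

Lemma clsE (x y : starexp) : cls x = cls y <-> sequiv x y.
Proof.
split=> [xy|xy].
  exact/asboolP/(eqmodP sequivb_equiv).
by apply/(eqmodP sequivb_equiv)/asboolP.
Qed.

Lemma clsP (x y : starexp) : sequiv x y -> cls x = cls y.
Proof. by move/clsE. Qed.

Lemma repP (x : starexp) : sequiv (rep (cls x)) x.
Proof. by apply/clsE/repK. Qed.

Definition nc_add (u v : NC) : NC := cls (Sadd (rep u) (rep v)).
Definition nc_mul (u v : NC) : NC := cls (Smul (rep u) (rep v)).
Definition nc_star (u : NC) : NC := cls (Sstar (rep u)).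
Definition nc_scale (c : R[i]) (u : NC) : NC := cls (Smul (Sconst c) (rep u)).
Definition nc_const (c : R[i]) : NC := cls (Sconst c).

Lemma nc_addE x y : nc_add (cls x) (cls y) = cls (Sadd x y).
Proof. by apply: clsP; apply: sequiv_add; exact: repP. Qed.

Lemma nc_mulE x y : nc_mul (cls x) (cls y) = cls (Smul x y).
Proof. by apply: clsP; apply: sequiv_mul; exact: repP. Qed.

Lemma nc_starE x : nc_star (cls x) = cls (Sstar x).
Proof. by apply: clsP; apply: sequiv_star; exact: repP. Qed.

Lemma nc_scaleE c u : nc_scale c u = nc_mul (nc_const c) u.
Proof.
by rewrite -[u]repK nc_mulE; apply: clsP; rewrite repK; exact: sequiv_refl.
Qed.

Definition ncE := (nc_addE, nc_mulE, nc_starE).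

Lemma nc_ind (P : NC -> Prop) : (forall x, P (cls x)) -> forall u, P u.
Proof. by move=> Pcls u; rewrite -[u]repK. Qed.

Lemma nc_addA : associative nc_add.
Proof.
by do 3![elim/nc_ind => ?]; rewrite !ncE; apply: clsP; exact: sequiv_addA.
Qed.

Lemma nc_addC : commutative nc_add.
Proof.
by do 2![elim/nc_ind => ?]; rewrite !ncE; apply: clsP; exact: sequiv_addC.
Qed.

Lemma nc_add0 : left_id (nc_const 0) nc_add.
Proof. by elim/nc_ind => ?; rewrite !ncE; apply: clsP; exact: sequiv_add0. Qed.

Lemma nc_mulA : associative nc_mul.
Proof.
by do 3![elim/nc_ind => ?]; rewrite !ncE; apply: clsP; exact: sequiv_mulA.
Qed.

Lemma nc_constC c u : nc_mul (nc_const c) u = nc_mul u (nc_const c).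
Proof.
by elim/nc_ind: u => ?; rewrite !ncE; apply: clsP; exact: sequiv_constC.
Qed.

Lemma nc_mul1 : left_id (nc_const 1) nc_mul.
Proof. by elim/nc_ind => ?; rewrite !ncE; apply: clsP; exact: sequiv_mul1. Qed.

Lemma nc_mulr1 : right_id (nc_const 1) nc_mul.
Proof. by move=> u; rewrite -nc_constC nc_mul1. Qed.

Lemma nc_mulDl : left_distributive nc_mul nc_add.
Proof.
by do 3![elim/nc_ind => ?]; rewrite !ncE; apply: clsP; exact: sequiv_mulDl.
Qed.

Lemma nc_mulDr : right_distributive nc_mul nc_add.
Proof.
by do 3![elim/nc_ind => ?]; rewrite !ncE; apply: clsP; exact: sequiv_mulDr.
Qed.

Lemma nc_constD c d : nc_const (c + d) = nc_add (nc_const c) (nc_const d).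
Proof. by rewrite ncE; apply: clsP; exact: sequiv_constD. Qed.

Lemma nc_constM c d : nc_const (c * d) = nc_mul (nc_const c) (nc_const d).
Proof. by rewrite ncE; apply: clsP; exact: sequiv_constM. Qed.

(* A two-dimensional model, showing 1 <> 0. *)
Fixpoint mxeval (x : starexp) : 'M[R[i]]_2 :=
  match x with
  | Sgen => delta_mx 0 1
  | Sconst c => c%:M
  | Sadd x y => mxeval x + mxeval y
  | Smul x y => mxeval x * mxeval y
  | Sstar x => star (mxeval x)
  end.

Lemma mxevalP x y : sequiv x y -> mxeval x = mxeval y.
Proof.
elim=> //=.
- by move=> ? ? ? _ -> _ ->.
- by move=> ? ? ? ? _ -> _ ->.
- by move=> ? ? ? ? _ -> _ ->.
- by move=> ? ? _ ->.
- by move=> *; rewrite addrA.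
- by move=> *; rewrite addrC.
- by move=> x'; rewrite raddf0 add0r.
- by move=> x'; rewrite raddf0 mul0r.
- by move=> *; rewrite mulrA.
- by move=> x'; rewrite mul1r.
- by move=> *; rewrite mulrDl.
- by move=> *; rewrite mulrDr.
- by move=> c d; rewrite raddfD.
- by move=> c d; rewrite scalar_mxM.
- by move=> c x'; rewrite -[LHS]/(_ *m _) -[RHS]/(_ *m _) scalar_mxC.
- by move=> x'; rewrite starK.
- by move=> *; rewrite starD.
- by move=> *; rewrite starM.
- by move=> c; rewrite /star /= /mxstar tr_scalar_mx map_scalar_mx.
- rewrite /star /= /mxstar trmx_delta map_delta_mx.
  rewrite -[_ * _]/(_ *m _) -[delta_mx 0 1 * _]/(_ *m _) !mul_delta_mx.
  by apply/matrixP => i j; rewrite !mxE; case: i => -[|[|//]] ?;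
    case: j => -[|[|//]] ? //=; rewrite ?addr0 ?add0r.
Qed.

Lemma nc_1neq0 : nc_const 1 != nc_const 0.
Proof.
apply/eqP => /clsE/mxevalP/= /matrixP/(_ 0 0); rewrite !mxE eqxx.
by move/eqP; rewrite oner_eq0.
Qed.

Lemma nc_mul0 u : nc_mul (nc_const 0) u = nc_const 0.
Proof. by elim/nc_ind: u => ?; rewrite !ncE; apply: clsP; exact: sequiv_mul0. Qed.

Lemma nc_addN : left_inverse (nc_const 0) (nc_scale (-1)) nc_add.
Proof.
move=> u; rewrite nc_scaleE -[X in nc_add _ X]nc_mul1 -nc_mulDl -nc_constD.
by rewrite addNr nc_mul0.
Qed.

Lemma nc_scaleA c d u : nc_scale c (nc_scale d u) = nc_scale (c * d) u.
Proof. by rewrite !nc_scaleE nc_mulA -nc_constM. Qed.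

Lemma nc_scale1 : left_id 1 nc_scale.
Proof. by move=> u; rewrite nc_scaleE nc_mul1. Qed.

Lemma nc_scaleDr : right_distributive nc_scale nc_add.
Proof. by move=> c u v; rewrite !nc_scaleE nc_mulDr. Qed.

Lemma nc_scaleDl u : {morph nc_scale^~ u : c d / c + d >-> nc_add c d}.
Proof. by move=> c d; rewrite !nc_scaleE nc_constD nc_mulDl. Qed.

Lemma nc_scaleAl c u v : nc_scale c (nc_mul u v) = nc_mul (nc_scale c u) v.
Proof. by rewrite !nc_scaleE nc_mulA. Qed.

Lemma nc_scaleAr c u v : nc_scale c (nc_mul u v) = nc_mul u (nc_scale c v).
Proof. by rewrite !nc_scaleE nc_mulA nc_constC -!nc_mulA nc_constC. Qed.

Lemma nc_starK : involutive nc_star.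
Proof. by elim/nc_ind => ?; rewrite !ncE; apply: clsP; exact: sequiv_starK. Qed.

Lemma nc_starD : {morph nc_star : u v / nc_add u v}.
Proof.
by do 2![elim/nc_ind => ?]; rewrite !ncE; apply: clsP; exact: sequiv_starD.
Qed.

Lemma nc_starM u v : nc_star (nc_mul u v) = nc_mul (nc_star v) (nc_star u).
Proof.
elim/nc_ind: u => ?; elim/nc_ind: v => ?; rewrite !ncE; apply: clsP.
exact: sequiv_starM.
Qed.

Lemma nc_starZ c u : nc_star (nc_scale c u) = nc_scale c^* (nc_star u).
Proof.
have starC : nc_star (nc_const c) = nc_const c^*.
  by rewrite nc_starE; apply: clsP; exact: sequiv_starC.
by rewrite !nc_scaleE nc_starM starC nc_constC.
Qed.

HB.instance Definition _ := GRing.isZmodule.Build NC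
  nc_addA nc_addC nc_add0 nc_addN.

HB.instance Definition _ := GRing.Zmodule_isNzRing.Build NC
  nc_mulA nc_mul1 nc_mulr1 nc_mulDl nc_mulDr nc_1neq0.

HB.instance Definition _ := GRing.Zmodule_isLmodule.Build R[i] NC
  nc_scaleA nc_scale1 nc_scaleDr nc_scaleDl.

HB.instance Definition _ := GRing.Lmodule_isLalgebra.Build R[i] NC nc_scaleAl.

HB.instance Definition _ := GRing.Lalgebra_isAlgebra.Build R[i] NC nc_scaleAr.

HB.instance Definition _ := hasStar.Build R[i] NC
  nc_starK nc_starD nc_starZ nc_starM.

End Presentation.

Section DiskAlgebra.
Variable R : realType.
Local Notation M2 := 'M[R[i]]_2.

Definition expi (t : R) : R[i] := Complex (cos t) (sin t).

Lemma expi_conj t : expi t * (expi t)^* = 1.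
Proof.
apply/eqP; rewrite eq_complex /= mulrN opprK -!expr2 cos2Dsin2 eqxx /=.
by rewrite mulrN mulrC addNr.
Qed.

Lemma norm_expi t : `|expi t| = 1.
Proof.
by apply/eqP; rewrite -(@pexpr_eq1 _ _ 2) ?normr_ge0 // normCK expi_conj.
Qed.

Definition closed_disk : set R[i] := [set z | `|z| <= 1].

Lemma expi_disk t : expi t \in closed_disk.
Proof. by apply/mem_set; rewrite /closed_disk /= norm_expi. Qed.

Definition circle_pt (t : R) : closed_disk := exist _ (expi t) (expi_disk t).

Definition twist (t : R) : M2 :=
  ((Num.sqrt 2)^-1)%:C%C *: \matrix_(i, j)
    (if i == 0 then if j == 0 then expi (t / 2) else - expi (t / 2) else 1).

Lemma twist_unitary t : twist t \is unitarymx.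
Proof.
set s : R[i] := ((Num.sqrt 2)^-1)%:C%C.
have ss : s * s^* = 2^-1.
  have -> : s^* = s by apply/eqP; rewrite eq_complex /= oppr0 !eqxx.
  by rewrite /s -rmorphM -invfM -expr2 sqr_sqrtr // fmorphV rmorph_nat.
have half (x y z : R[i]) : x + y = z *+ 2 -> x * (s * s^*) + y * (s * s^*) = z.
  by move=> xyz; rewrite ss -mulrDl xyz -[z *+ 2]mulr_natr mulfK // pnatr_eq0.
have e1 := expi_conj (t / 2).
apply/unitarymxP/matrixP => i j.
rewrite !mxE big_ord_recr /= big_ord1 !mxE -/s !rmorphM /=.
rewrite ![s * _ * (s^* * _)]mulrACA ![s * s^* * _]mulrC; apply: half.
case: i j => -[|[|//]] ? [[|[|//]] ?]; rewrite /= ?rmorphN ?rmorph1;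
  by rewrite ?mulrNN ?mulr1 ?mul1r ?e1 ?subrr ?mul0rn // addrC subrr.
Qed.

Lemma mx_continuousP (T : topologicalType) (f : T -> M2) :
  (forall i j, continuous (fun z => f z i j)) -> continuous f.
Proof.
move=> fc z A [P nP sPA].
have Pf : \forall y \near z, forall i j, P i j (f y i j).
  by apply: filter_forall => i; apply: filter_forall => j; exact/fc/nP.
by apply: filterS Pf => y; exact: sPA.
Qed.

Lemma mx_entry_continuous (T : topologicalType) (f : T -> M2) i j :
  continuous f -> continuous (fun z => f z i j).
Proof.
move=> fc z; apply: (@continuous_comp _ _ _ f (fun M : M2 => M i j)).
  exact: fc.
exact: coord_continuous.
Qed.

Lemma mxD_continuous (T : topologicalType) (f g : T -> M2) :
  continuous f -> continuous g -> continuous (fun z => f z + g z).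
Proof.
move=> fc gc; apply: mx_continuousP => i j z.
rewrite (_ : (fun z => _) = (fun z => f z i j + g z i j)); last first.
  by apply/funext => y; rewrite mxE.
by apply: continuousD; exact: mx_entry_continuous.
Qed.

Lemma mxM_continuous (T : topologicalType) (f g : T -> M2) :
  continuous f -> continuous g -> continuous (fun z => f z * g z).
Proof.
move=> fc gc; apply: mx_continuousP => i j z.
rewrite (_ : (fun z => _) =
    (fun z => f z i 0 * g z 0 j + f z i 1 * g z 1 j)); last first.
  apply/funext => y; rewrite mxE big_ord_recr /= big_ord1.
  by congr (f y _ _ * g y _ _ + f y _ _ * g y _ _); exact/val_inj.
by apply: cvgD; apply: cvgM; exact: mx_entry_continuous.
Qed.

Lemma mxZ_continuous (T : topologicalType) (c : R[i]) (f : T -> M2) :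
  continuous f -> continuous (fun z => c *: f z).
Proof.
move=> fc; apply: mx_continuousP => i j z.
rewrite (_ : (fun z => _) = (fun z => c * f z i j)); last first.
  by apply/funext => y; rewrite mxE.
by apply: cvgM; [exact: cvg_cst|exact: mx_entry_continuous].
Qed.

Lemma conjC_continuous : continuous (fun c : R[i] => c^*).
Proof.
move=> c A /nbhs_ballP[e /= e0 eA]; apply/nbhs_ballP; exists e => //= d cd.
by apply: eA; move: cd; rewrite -!ball_normE /ball_ /= -rmorphB norm_conjC.
Qed.

Lemma mxstar_continuous (T : topologicalType) (f : T -> M2) :
  continuous f -> continuous (fun z => star (f z)).
Proof.
move=> fc; apply: mx_continuousP => i j z.
rewrite (_ : (fun z => _) = (fun c => c^*) \o (fun z => f z j i)); last first.
  by apply/funext => y; rewrite !mxE.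
apply: (@continuous_comp _ _ _ (fun z => f z j i) (fun c => c^*)).
  exact: mx_entry_continuous.
exact: conjC_continuous.
Qed.

Local Open Scope sesquilinear_scope.

(* is_diag_mx picks out the diagonal copy of C (+) C in M_2(C);
   [t] is the angle phi, and [circle_pt t] the boundary point e^(i phi). *)
Definition A1_set : set (closed_disk -> M2) := [set f |
  continuous f /\
  forall t : R, 0 <= t <= 2 * pi ->
    is_diag_mx ((twist t)^t* *m f (circle_pt t) *m twist t)].

(* The pointwise unital *-algebra of the f in A1_set. *)
Definition A1 : Type := A1_set.

HB.instance Definition _ := Choice.on A1.

Definition A1val (u : A1) : closed_disk -> M2 := set_val u.

Lemma A1val_inj : injective A1val.
Proof. exact: val_inj. Qed.

Lemma A1valP u : A1_set (A1val u).
Proof. exact: set_valP. Qed.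

Definition A1mk (f : closed_disk -> M2) (Pf : A1_set f) : A1 :=
  exist _ f (mem_set Pf).

Lemma A1mkK f Pf : A1val (@A1mk f Pf) = f.
Proof. by []. Qed.

Lemma A1_cst (c : R[i]) : A1_set (fun=> c%:M).
Proof.
split=> [z|t _]; first exact: cst_continuous.
have tt : (twist t)^t* *m twist t = 1%:M.
  by rewrite -[X in X *m _]mul1mx mulmxKtV // twist_unitary.
rewrite mul_mx_scalar -scalemxAl tt.
apply/is_diag_mxP => i j ij; rewrite !mxE.
by rewrite -val_eqE (negbTE ij) mulr0.
Qed.

Lemma A1_D u v : A1_set (fun z => A1val u z + A1val v z).
Proof.
have [uc ud] := A1valP u; have [vc vd] := A1valP v.
split=> [|t tpi]; first exact: (mxD_continuous uc vc).
apply/is_diag_mxP => i j ij; rewrite mulmxDr mulmxDl mxE.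
by rewrite (is_diag_mxP (ud t tpi)) // (is_diag_mxP (vd t tpi)) // addr0.
Qed.

Lemma A1_Z c u : A1_set (fun z => c *: A1val u z).
Proof.
have [uc ud] := A1valP u.
split=> [|t tpi]; first exact: (mxZ_continuous uc).
apply/is_diag_mxP => i j ij; rewrite -(scalemxAr c) -(scalemxAl c) mxE.
by rewrite (is_diag_mxP (ud t tpi)) // mulr0.
Qed.

Lemma A1_M u v : A1_set (fun z => A1val u z * A1val v z).
Proof.
have [uc ud] := A1valP u; have [vc vd] := A1valP v.
split=> [|t tpi]; first exact: (mxM_continuous uc vc).
have -> : (twist t)^t* *m (A1val u (circle_pt t) * A1val v (circle_pt t)) *m
    twist t = ((twist t)^t* *m A1val u (circle_pt t) *m twist t) *m
              ((twist t)^t* *m A1val v (circle_pt t) *m twist t).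
  by rewrite !mulmxA (mulmxtVK _ (twist_unitary t)) -!mulmxA.
apply/is_diag_mxP => i j ij; rewrite mxE big1 // => k _.
have [ik|ik] := eqVneq (i : nat) k.
  by rewrite (is_diag_mxP (vd t tpi)) ?mulr0 // -ik.
by rewrite (is_diag_mxP (ud t tpi)) ?mul0r.
Qed.

Lemma A1_star u : A1_set (fun z => star (A1val u z)).
Proof.
have [uc ud] := A1valP u.
split=> [|t tpi]; first exact: (mxstar_continuous uc).
have -> : (twist t)^t* *m star (A1val u (circle_pt t)) *m twist t =
    ((twist t)^t* *m A1val u (circle_pt t) *m twist t)^t*.
  by rewrite !trmx_mul !map_mxM trmxCK mulmxA.
apply/is_diag_mxP => i j ij; rewrite mxE mxE.
by rewrite (is_diag_mxP (ud t tpi)) ?rmorph0 // eq_sym.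
Qed.

Definition A1_const c : A1 := A1mk (A1_cst c).
Definition A1_add u v : A1 := A1mk (A1_D u v).
Definition A1_scale c u : A1 := A1mk (A1_Z c u).
Definition A1_opp u : A1 := A1_scale (-1) u.
Definition A1_mul u v : A1 := A1mk (A1_M u v).
Definition A1_adj u : A1 := A1mk (A1_star u).

Lemma A1P (u v : A1) : (forall z, A1val u z = A1val v z) -> u = v.
Proof. by move=> uv; apply/A1val_inj/funext. Qed.

Lemma A1_addA : associative A1_add.
Proof. by move=> u v w; apply: A1P => z; exact: addrA. Qed.

Lemma A1_addC : commutative A1_add.
Proof. by move=> u v; apply: A1P => z; exact: addrC. Qed.

Lemma A1_add0 : left_id (A1_const 0) A1_add.
Proof. move=> u; apply: A1P => z.
by rewrite -[LHS]/(0%:M + A1val u z) raddf0 add0r. Qed.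

Lemma A1_addN : left_inverse (A1_const 0) A1_opp A1_add.
Proof. move=> u; apply: A1P => z.
by rewrite -[LHS]/(-1 *: A1val u z + A1val u z) scaleN1r addNr -[RHS]/0%:M raddf0. Qed.

HB.instance Definition _ := GRing.isZmodule.Build A1
  A1_addA A1_addC A1_add0 A1_addN.

Lemma A1_mulA : associative A1_mul.
Proof. by move=> u v w; apply: A1P => z; exact: mulrA. Qed.

Lemma A1_mul1 : left_id (A1_const 1) A1_mul.
Proof. by move=> u; apply: A1P => z; exact: mul1r. Qed.

Lemma A1_mulr1 : right_id (A1_const 1) A1_mul.
Proof. by move=> u; apply: A1P => z; exact: mulr1. Qed.

Lemma A1_mulDl : left_distributive A1_mul A1_add.
Proof. by move=> u v w; apply: A1P => z; exact: mulrDl. Qed.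

Lemma A1_mulDr : right_distributive A1_mul A1_add.
Proof. by move=> u v w; apply: A1P => z; exact: mulrDr. Qed.

Lemma A1_1neq0 : A1_const 1 != A1_const 0.
Proof.
apply/eqP => /(congr1 (fun u => A1val u (circle_pt 0) 0 0)) /=.
by rewrite !mxE eqxx => /eqP; rewrite oner_eq0.
Qed.

HB.instance Definition _ := GRing.Zmodule_isNzRing.Build A1
  A1_mulA A1_mul1 A1_mulr1 A1_mulDl A1_mulDr A1_1neq0.

Lemma A1_scaleA c d u : A1_scale c (A1_scale d u) = A1_scale (c * d) u.
Proof. by apply: A1P => z; exact: scalerA. Qed.

Lemma A1_scale1 : left_id 1 A1_scale.
Proof. by move=> u; apply: A1P => z; exact: scale1r. Qed.

Lemma A1_scaleDr : right_distributive A1_scale A1_add.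
Proof. by move=> c u v; apply: A1P => z; exact: scalerDr. Qed.

Lemma A1_scaleDl u : {morph A1_scale^~ u : c d / c + d >-> A1_add c d}.
Proof. by move=> c d; apply: A1P => z; exact: scalerDl. Qed.

HB.instance Definition _ := GRing.Zmodule_isLmodule.Build R[i] A1
  A1_scaleA A1_scale1 A1_scaleDr A1_scaleDl.

Lemma A1_scaleAl c (u v : A1) : c *: (u * v) = (c *: u) * v.
Proof. by apply: A1P => z; exact: scalerAl. Qed.

HB.instance Definition _ := GRing.Lmodule_isLalgebra.Build R[i] A1 A1_scaleAl.

Lemma A1_scaleAr c (u v : A1) : c *: (u * v) = u * (c *: v).
Proof. by apply: A1P => z; exact: scalerAr. Qed.

HB.instance Definition _ := GRing.Lalgebra_isAlgebra.Build R[i] A1 A1_scaleAr.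

Lemma A1_adjK : involutive A1_adj.
Proof. by move=> u; apply: A1P => z; exact: starK. Qed.

Lemma A1_adjD : {morph A1_adj : u v / u + v}.
Proof. by move=> u v; apply: A1P => z; exact: starD. Qed.

Lemma A1_adjZ c u : A1_adj (c *: u) = c^* *: A1_adj u.
Proof. by apply: A1P => z; exact: starZ. Qed.

Lemma A1_adjM u v : A1_adj (u * v) = A1_adj v * A1_adj u.
Proof. by apply: A1P => z; exact: starM. Qed.

HB.instance Definition _ := hasStar.Build R[i] A1
  A1_adjK A1_adjD A1_adjZ A1_adjM.

End DiskAlgebra.

(* Main.v *)
(* A_1 itself is shown to be the enveloping algebra; the universal property then
   identifies any other one with it.  The generator a is sent by rho to the
   matrix function a(w) = [[0, w / (2 beta)], [beta, 0]],
   beta^2 = (1 + sqrt (1 - |w|^2)) / 2, for which a(w)^2 = w / 2.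

   The C*-norm of A_1 dominates every C*-seminorm on the *-algebra.  From
   t a = a (1 - t) for t = a^* a, an element is a finite sum of homogeneous
   components a^k g(t) and (a^* )^k g(t), and v^* v is a polynomial in t for such
   a component v, so that |phi v| <= |rho v| follows from
   |f(t)| <= sup_[0,1] |f|.  Averaging the gauge action a -> l a over roots of
   unity bounds each component in A_1 by the whole element, hence
   |phi p| <= C deg(p) |rho p|, and applying this to (p^* p)^N for N = 2^n removes
   the constant.  The same power trick, with the Fourier expansion of f at
   cos s = Re u for u unitary, gives the bound on f(t).

   Density of the image is a two-dimensional Bernstein argument: w is the mean of
   a random walk whose step probabilities are affine in Re w and Im w, hence lie
   in the image, and near each node the given function is approximated by a
   polynomial in a and a^* that agrees with it at the node. *)

Require Import Defs.
From HB Require Import structures.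
From mathcomp Require Import all_boot all_order all_algebra.
From mathcomp Require Import spectral complex separable cyclic cyclotomic.
From mathcomp Require Import all_classical all_reals all_analysis.
From mathcomp Require Import ring lra zify.

Set Implicit Arguments.
Unset Strict Implicit.
Unset Printing Implicit Defensive.

Import Order.TTheory GRing.Theory Num.Theory.
Import numFieldNormedType.Exports.

Local Open Scope classical_set_scope.
Local Open Scope ring_scope.

(** * Star algebras and C*-algebras *)

(** The square of [a] is central, so an irreducible representation turns it into a scalar [w / 2];
    this is the origin of the disk. On the circle both eigenvalues of [t] equal 1/2, [a] becomes
    normal and the two-dimensional model splits along its eigenlines, which the columns of V span;
    this is the origin of the boundary condition. No representation is classified and no spectrum is
    used. The obstacle is to bound norms in an arbitrary C*-algebra, and all that is needed there
    comes from one iterative square root: it exhibits self-adjoint elements as real parts of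
    unitaries, for which bounds come from averaging. Positivity appears only as a norm estimate on
    [r^2 - k^2]. Crude bounds may lose a factor proportional to the degree, because the degree of a
    power grows linearly while the C*-identity makes the norms of its repeated squares exact. In the
    density argument, pointwise approximants can be glued without leaving the image because the real
    and imaginary parts of [w] are central elements of it. *)

Section StarAlgebra.
Variables (C : numClosedFieldType) (A : starAlgType C).
Implicit Types x y : A.

Lemma star0 : star (0 : A) = 0.
Proof. by apply: (addrI (star 0)); rewrite -starD !addr0. Qed.

Lemma starN x : star (- x) = - star x.
Proof. by apply: (addrI (star x)); rewrite -starD !subrr star0. Qed.

Lemma starB x y : star (x - y) = star x - star y.
Proof. by rewrite starD starN. Qed.

Lemma star1 : star (1 : A) = 1.
Proof. by rewrite -[RHS]starK -[star 1 in RHS]mul1r starM starK mul1r. Qed.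

Lemma starX x n : star (x ^+ n) = star x ^+ n.
Proof.
elim: n => [|n IHn]; first by rewrite star1.
by rewrite exprS starM IHn exprSr.
Qed.

End StarAlgebra.

Section StarHom.
Variables (C : numClosedFieldType) (A B : starAlgType C) (phi : A -> B).
Hypothesis phiH : star_hom phi.

Lemma star_hom0 : phi 0 = 0.
Proof.
by have := star_hom_linear phiH (-1) 0 0; rewrite scaler0 addr0 scaleN1r addNr.
Qed.

Lemma star_homZ c x : phi (c *: x) = c *: phi x.
Proof. by have := star_hom_linear phiH c x 0; rewrite !addr0 star_hom0 addr0. Qed.

Lemma star_homD x y : phi (x + y) = phi x + phi y.
Proof. by have := star_hom_linear phiH 1 x y; rewrite !scale1r. Qed.

Lemma star_homB x y : phi (x - y) = phi x - phi y.
Proof. by rewrite star_homD -scaleN1r star_homZ scaleN1r. Qed.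

Lemma star_homX x n : phi (x ^+ n) = phi x ^+ n.
Proof.
elim: n => [|n IHn]; first exact: star_hom1.
by rewrite !exprS (star_homM phiH) IHn.
Qed.

Lemma star_hom_sum (I : Type) (r : seq I) (P : pred I) (F : I -> A) :
  phi (\sum_(i <- r | P i) F i) = \sum_(i <- r | P i) phi (F i).
Proof. exact: (big_morph _ star_homD star_hom0). Qed.

End StarHom.

Section CStarBasics.
Variables (R : realType) (B : cstarAlgType R).
Implicit Types x y z s u : B.

Lemma normcN1 : complex.Re `|(-1 : R[i])| = 1.
Proof. by rewrite normrN1. Qed.

Lemma cnorm0 : cnorm (0 : B) = 0.
Proof. by rewrite -(scale0r 0) cnormZ normr0 mul0r. Qed.

Lemma cnormN x : cnorm (- x) = cnorm x.
Proof. by rewrite -scaleN1r cnormZ normcN1 mul1r. Qed.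

Lemma cnormBC x y : cnorm (x - y) = cnorm (y - x).
Proof. by rewrite -cnormN opprB. Qed.

Lemma cnorm_ge0 x : 0 <= cnorm x.
Proof. by have := cnormD x (- x); rewrite subrr cnorm0 cnormN; lra. Qed.

Lemma cnorm_triangle y x z : cnorm (x - z) <= cnorm (x - y) + cnorm (y - z).
Proof.
by apply: le_trans (cnormD _ _); rewrite addrA subrK.
Qed.

Lemma cnormS x : cnorm (star x) = cnorm x.
Proof.
have le y : cnorm y <= cnorm (star y).
  have [->|y0] := eqVneq (cnorm y) 0; first exact: cnorm_ge0.
  have yp : 0 < cnorm y by rewrite lt_def y0 cnorm_ge0.
  by rewrite -(ler_pM2r yp) -expr2 -cnorm_star cnormM.
by apply/le_anti; rewrite le andbT; apply: le_trans (le _) _; rewrite starK.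
Qed.

Lemma cnorm1 : cnorm (1 : B) = 1.
Proof.
have := cnorm_star (1 : B); rewrite star1 mulr1 => e1.
have /negP n0 : cnorm (1 : B) != 0.
  by apply/eqP => /cnorm_eq0/eqP; rewrite oner_eq0.
have /eqP : cnorm (1 : B) * (cnorm (1 : B) - 1) = 0.
  by rewrite mulrBr -expr2 -e1 mulr1 subrr.
by rewrite mulf_eq0 => /orP[/n0//|]; rewrite subr_eq0 => /eqP.
Qed.

Lemma cnormX x n : cnorm (x ^+ n) <= cnorm x ^+ n.
Proof.
elim: n => [|n IHn]; first by rewrite cnorm1.
rewrite !exprS; apply: le_trans (cnormM _ _) _.
by rewrite ler_wpM2l ?cnorm_ge0.
Qed.

(** The C*-identity is exact for squares, so equality propagates along repeated squaring; this is
    why every power argument runs over [2 ^ n]. *)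
Lemma cnormX_sa x n : star x = x -> cnorm (x ^+ (2 ^ n)) = cnorm x ^+ (2 ^ n).
Proof.
move=> xsa; elim: n => [//|n IHn].
by rewrite expnSr 2!exprM -IHn -cnorm_star starX xsa expr2.
Qed.

Lemma cnorm_sum (I : Type) (r : seq I) (P : pred I) (F : I -> B) :
  cnorm (\sum_(i <- r | P i) F i) <= \sum_(i <- r | P i) cnorm (F i).
Proof.
elim/big_ind2: _ => [|x1 u y1 v lex ley|//]; first by rewrite cnorm0.
exact: le_trans (cnormD _ _) (lerD lex ley).
Qed.

Lemma cnorm_small (C : R) x :
  (forall e, 0 < e -> cnorm x <= C * e) -> x = 0.
Proof.
move=> h; apply: cnorm_eq0; apply/le_anti; rewrite cnorm_ge0 andbT.
rewrite leNgt; apply/negP => xp.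
have [C0|C0] := leP C 0.
  by have := h 1 ltr01; rewrite mulr1; lra.
have := h (cnorm x / (C * 2)) (divr_gt0 xp (mulr_gt0 C0 (ltr0Sn R 1))).
by rewrite invfM mulrCA [C * _]mulrA divff ?gt_eqF// mul1r; lra.
Qed.

Lemma cnorm_unitary u : star u * u = 1 -> cnorm u = 1.
Proof.
move=> uu; have /eqP := cnorm_star u; rewrite uu cnorm1 eq_sym.
by rewrite sqrp_eq1 ?cnorm_ge0// => /eqP.
Qed.

Lemma cstar_complete (u : nat -> B) :
  (forall e : R, 0 < e -> exists N : nat, forall m n : nat,
      (N <= m)%N -> (N <= n)%N -> cnorm (u m - u n) < e) ->
  exists l, forall e : R, 0 < e -> exists N : nat, forall n : nat,
      (N <= n)%N -> cnorm (u n - l) < e.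
Proof.
move=> /cnorm_complete[l /cvgrPdist_lt ul]; exists l => e /ul[N _ uN].
exists N => n Nn; have := uN n Nn.
by rewrite sub0r normrN ger0_norm ?cnorm_ge0.
Qed.

(* 1 - r is a square root of 1 - s when r = (s + r^2) / 2, and for |s| < 1 the
   right-hand side is a contraction of the ball of radius |s|. *)
Section SquareRoot.
Variable s : B.
Hypotheses (ssa : star s = s) (s1 : cnorm s < 1).
Let sg := cnorm s.

Fixpoint sqrt_iter n : B :=
  if n is n'.+1 then 2^-1 *: (s + sqrt_iter n' * sqrt_iter n') else 0.
Local Notation r := sqrt_iter.

Lemma cnorm_half x : cnorm (2^-1 *: x) = 2^-1 * cnorm x.
Proof.
rewrite cnormZ; congr (_ * _).
by rewrite ger0_norm ?invr_ge0// -(rmorph_nat (real_complex R) 2) -fmorphV.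
Qed.

Let sg0 : 0 <= sg. Proof. exact: cnorm_ge0. Qed.

Lemma sqrt_iter_le n : cnorm (r n) <= sg.
Proof.
elim: n => [|n IHn] /=; first by rewrite cnorm0.
rewrite cnorm_half; have := cnormD s (r n * r n).
have := cnormM (r n) (r n).
have : cnorm (r n) * cnorm (r n) <= sg * 1.
  by rewrite ler_pM ?cnorm_ge0// (le_trans IHn)// ltW.
by rewrite -/sg; lra.
Qed.

Lemma sqrB x y : x * x - y * y = x * (x - y) + (x - y) * y.
Proof. by rewrite mulrBr mulrBl addrA subrK. Qed.

Lemma cnorm_sqrB x y c : cnorm x <= c -> cnorm y <= c ->
  cnorm (x * x - y * y) <= 2 * c * cnorm (x - y).
Proof.
move=> xc yc; rewrite sqrB.
have := cnormD (x * (x - y)) ((x - y) * y).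
have := cnormM x (x - y); have := cnormM (x - y) y.
have := ler_wpM2r (cnorm_ge0 (x - y)) xc.
have := ler_wpM2l (cnorm_ge0 (x - y)) yc.
lra.
Qed.

(** On the ball of radius [sg] squaring is Lipschitz with constant [2 * sg], and the factor 1/2 of
    the iteration leaves the ratio [sg]. *)
Lemma sqrt_iter_step n : cnorm (r n.+1 - r n) <= sg ^+ n.
Proof.
elim: n => [|n IHn].
  rewrite expr0 subr0; apply: le_trans (sqrt_iter_le 1) _; exact: ltW.
rewrite [X in X - _]/= [X in _ - X]/= -scalerBr opprD addrACA subrr add0r.
rewrite cnorm_half.
have := cnorm_sqrB (sqrt_iter_le n.+1) (sqrt_iter_le n).
have := ler_wpM2l sg0 IHn; rewrite -exprS; lra.
Qed.

(** The telescoped geometric series, multiplied through by [1 - sg]. *)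
Lemma sqrt_iter_dist n k :
  cnorm (r (n + k) - r n) * (1 - sg) <= sg ^+ n - sg ^+ (n + k).
Proof.
elim: k => [|k IHk]; first by rewrite addn0 !subrr cnorm0 mul0r.
rewrite addnS.
have sp : 0 <= 1 - sg by rewrite subr_ge0 ltW.
have := ler_wpM2r sp (cnorm_triangle (r (n + k)) (r (n + k).+1) (r n)).
have := ler_wpM2r sp (sqrt_iter_step (n + k)).
by rewrite exprS; nra.
Qed.

Lemma sqrt_iter_cauchy (e : R) : 0 < e -> exists N : nat, forall m n : nat,
  (N <= m)%N -> (N <= n)%N -> cnorm (r m - r n) < e.
Proof.
move=> e0.
have sp : 0 < 1 - sg by rewrite subr_gt0.
have [N _ /(_ N (leqnn N))] :
    \forall n \near \oo, `|0 - sg ^+ n| < e * (1 - sg) / 2.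
  apply: (@cvgr_dist_lt _ R^o); last by rewrite divr_gt0// mulr_gt0.
  by apply: cvg_expr; rewrite ger0_norm.
rewrite sub0r normrN ger0_norm ?exprn_ge0// => sN.
have half m : (N <= m)%N -> cnorm (r m - r N) < e / 2.
  move=> /subnKC <-; rewrite -(ltr_pM2r sp).
  apply: le_lt_trans (sqrt_iter_dist _ _) _.
  have := exprn_ge0 (N + (m - N)) sg0; lra.
exists N => m n /half hm /half hn.
by have := cnorm_triangle (r N) (r m) (r n); rewrite [cnorm (r N - _)]cnormBC; lra.
Qed.

(** The root is a limit of polynomials in [s], so it commutes with whatever commutes with [s]; this
    clause is what lets it serve as the sine next to a given cosine. *)
Lemma sqrt_exists : exists y, [/\ star y = y, y * y = 1 - s &
  forall x, x * s = s * x -> x * y = y * x].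
Proof.
have [l hl] := cstar_complete sqrt_iter_cauchy.
have close e : 0 < e -> exists n, cnorm (r n - l) < e /\ cnorm (r n.+1 - l) < e.
  by move=> /hl[N hN]; exists N; split; apply: hN.
have l1 : cnorm l <= 1.
  apply/ler_addgt0Pr => e /close[n [hn _]].
  have := cnorm_triangle (r n) l 0; rewrite !subr0 cnormBC.
  by have := sqrt_iter_le n; move: (s1); rewrite -/sg; lra.
have rsa n : star (r n) = r n.
  by elim: n => [|n IHn] /=; rewrite ?star0// starZ starD starM IHn ssa
    fmorphV rmorph_nat.
have rcomm x n : x * s = s * x -> x * r n = r n * x.
  move=> xs; elim: n => [|n IHn] /=; first by rewrite mulr0 mul0r.
  by rewrite -scalerAr -scalerAl mulrDr mulrDl xs mulrA IHn -mulrA IHn mulrA.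
have lE : l = 2^-1 *: (s + l * l).
  apply/eqP; rewrite -subr_eq0; apply/eqP; apply: (@cnorm_small 2) => e /close[n [hn hn1]].
  have := cnorm_triangle (r n.+1) l (2^-1 *: (s + l * l)).
  rewrite -[X in _ + cnorm X]scalerBr opprD addrACA subrr add0r cnorm_half [cnorm (l - r _)]cnormBC.
  have r1 : cnorm (r n) <= 1 := le_trans (sqrt_iter_le n) (ltW s1).
  by have := cnorm_sqrB r1 l1; lra.
exists (1 - l); split.
- rewrite starB star1; congr (_ - _); apply/eqP; rewrite -subr_eq0; apply/eqP.
  apply: (@cnorm_small 2) => e /close[n [hn _]].
  have := cnorm_triangle (r n) (star l) l.
  have -> : star l - r n = star (l - r n) by rewrite starB rsa.
  by rewrite cnormS [cnorm (l - r n)]cnormBC; lra.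
- have : l + l = s + l * l.
    by rewrite -mulr2n -scaler_nat {1}lE scalerA divff ?pnatr_eq0// scale1r.
  rewrite mulrBr !mulrBl !mulr1 mul1r => h.
  have -> : s = l + l - l * l by rewrite h addrK.
  by rewrite !opprB opprD -addrA [- l + _]addrCA.
- move=> x xs; rewrite mulrBr mulrBl mulr1 mul1r; congr (_ - _).
  apply/eqP; rewrite -subr_eq0; apply/eqP.
  apply: (@cnorm_small (2 * cnorm x)) => e /close[n [hn _]].
  have := cnorm_triangle (x * r n) (x * l) (l * x).
  rewrite -mulrBr [X in _ + cnorm (X - _)](rcomm x n xs) -mulrBl.
  have := cnormM x (l - r n); have := cnormM (r n - l) x.
  rewrite [cnorm (l - r n)]cnormBC.
  by have := ler_wpM2l (cnorm_ge0 x) (ltW hn); lra.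
Qed.

End SquareRoot.
End CStarBasics.

(** * Removing linear factors by taking powers *)

Section PowerTrick.
Variable R : realType.
Implicit Types c M K x : R.

Lemma bernoulli x n : 0 <= x -> 1 + n%:R * x <= (1 + x) ^+ n.
Proof.
move=> x0; elim: n => [|n IHn]; first by rewrite mul0r addr0.
rewrite exprS -natr1; have n0 : 0 <= n%:R :> R by [].
by have := mulr_ge0 n0 (mulr_ge0 x0 x0); nra.
Qed.

(** If [c / M = 1 + d] with [d > 0], one doubling of the exponent makes Bernoulli quadratic:
    [(1 + d)^(2N) >= (1 + N d)^2], which outgrows the linear factor [2N]. *)
Lemma power_trick c M K : 0 <= c -> 0 <= M ->
  (forall n, c ^+ (2 ^ n) <= K * (2 ^ n)%:R * M ^+ (2 ^ n)) -> c <= M.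
Proof.
move=> c0 M0 h; rewrite leNgt; apply/negP => Mc.
have [M00|Mp] : M = 0 \/ 0 < M by move: M0; rewrite le_eqVlt => /orP[/eqP|]; auto.
  by have := h 0; rewrite expn0 !expr1 M00 mulr0; lra.
set d := c / M - 1.
have d0 : 0 < d by rewrite subr_gt0 ltr_pdivlMr// mul1r.
have key n : (2 ^ n)%:R * d ^+ 2 <= 2 * K.
  have e1 : (1 + d) ^+ (2 ^ n.+1) <= K * (2 ^ n.+1)%:R.
    have -> : 1 + d = c / M by rewrite /d addrC subrK.
    by rewrite expr_div_n ler_pdivrMr ?exprn_gt0.
  have e2 := bernoulli (2 ^ n) (ltW d0).
  have n0 : 0 < (2 ^ n)%:R :> R by rewrite ltr0n expn_gt0.
  rewrite -(ler_pM2l n0); move: e1; rewrite expnSr natrM exprM.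
  have : (1 + (2 ^ n)%:R * d) ^+ 2 <= ((1 + d) ^+ (2 ^ n)) ^+ 2.
    have Nd := mulr_gt0 n0 d0.
    by rewrite ler_pXn2r// nnegrE ?exprn_ge0//; lra.
  have := mulr_gt0 n0 d0; rewrite !expr2; nra.
have d2 : 0 < d ^+ 2 by rewrite exprn_gt0.
have [n hn] : exists n : nat, 2 * K / d ^+ 2 < n%:R.
  exists (Num.truncn (2 * K / d ^+ 2)).+1; exact: truncnS_gt.
have := key n; rewrite -ler_pdivlMr// => /le_lt_trans/(_ hn).
by rewrite ltr_nat ltnNge ltnW// ltn_expl.
Qed.

End PowerTrick.

(** * Averaging over roots of unity *)

Section RootsOfUnity.
Variable R : realType.
Implicit Types (l c : R[i]).

Lemma prim_root_complex n : (n > 0)%N -> exists z : R[i], n.-primitive_root z.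
Proof.
pose p : {poly R[i]} := 'X^n - 1; have [r Dp] := closed_field_poly_normal p.
move=> n_gt0; rewrite (monicP _) ?monicXnsubC // scale1r in Dp.
have rn1 : all n.-unity_root r.
  by apply/allP => z; rewrite -root_prod_XsubC -Dp.
have sz_r : (n < (size r).+1)%N.
  by rewrite -(size_prod_XsubC r id) -Dp size_XnsubC.
have [|z _ zn] := hasP (has_prim_root n_gt0 rn1 _ sz_r); last by exists z.
by rewrite -separable_prod_XsubC -Dp separable_Xn_sub_1 // pnatr_eq0 -lt0n.
Qed.

(** Discrete Fourier inversion at the powers of a primitive root: for [j != k] the inner sum is
    geometric with ratio different from 1 and vanishes. The vectors are arbitrary, so that it
    extracts both polynomial coefficients and graded components. *)
Lemma root_average n : exists l : 'I_n -> R[i], (forall m, `|l m| = 1) /\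
  forall (V : lmodType R[i]) (v : nat -> V) k, (k < n)%N ->
    v k = n%:R^-1 *: \sum_(m < n) (l m) ^- k *: \sum_(j < n) l m ^+ j *: v j.
Proof.
have [->|n0] := posnP n; first by exists (fun=> 1); split=> [?|//]; rewrite normr1.
have [z zn] := prim_root_complex n0.
have z0 : z != 0 by rewrite (prim_root_eq0 zn) -lt0n.
have nz : `|z| = 1.
  apply/eqP; rewrite -(@pexpr_eq1 _ _ n)// -normrX (prim_expr_order zn).
  by rewrite normr1.
exists (fun m => z ^+ m); split=> [m|V v k kn].
  by rewrite normrX nz expr1n.
have nn : n%:R != 0 :> R[i] by rewrite pnatr_eq0 -lt0n.
apply: (canRL (scalerK nn)).
under eq_bigr do rewrite scaler_sumr.
rewrite exchange_big /= (bigD1 (Ordinal kn)) //= [X in _ + X]big1 ?addr0.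
  rewrite (eq_bigr (fun=> v k)) ?sumr_const ?card_ord ?scaler_nat// => m _.
  by rewrite scalerA mulVf ?scale1r// expf_neq0// expf_neq0.
move=> j jk; under eq_bigr do rewrite scalerA.
rewrite -scaler_suml; set q := z ^- k * z ^+ j.
have qE m : (z ^+ m) ^- k * (z ^+ m) ^+ j = q ^+ m.
  by rewrite /q exprMn exprVn -!exprM ![(m * _)%N]mulnC.
under eq_bigr do rewrite qE.
have q1 : q != 1.
  apply: contra jk; rewrite /q mulrC => /eqP/divr1_eq/eqP.
  by rewrite (eq_prim_root_expr zn) !modn_small.
have qn : q ^+ n = 1.
  by rewrite /q exprMn exprVn -!exprM ![(_ * n)%N]mulnC !exprM (prim_expr_order zn)
    !expr1n invr1 mulr1.
have := subrX1 q n; rewrite qn subrr => /esym/eqP.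
by rewrite mulf_eq0 subr_eq0 (negbTE q1) => /eqP ->; rewrite scale0r.
Qed.

End RootsOfUnity.

(** * The real-valued modulus on the complex numbers *)

Local Notation normc := (@Normc.normc _).

Section Modulus.
Variable R : realType.
Implicit Types (c d : R[i]) (x : R).

Lemma norm_normc c : `|c| = (normc c)%:C%C. Proof. by []. Qed.

Lemma normc_ge0 c : 0 <= normc c.
Proof. by rewrite -lecR -norm_normc rmorph0 normr_ge0. Qed.

Lemma normcD c d : normc (c + d) <= normc c + normc d.
Proof. exact: le_normcD. Qed.

Lemma normcB c d : normc (c - d) = normc (d - c).
Proof. by rewrite -opprB normcN. Qed.

Lemma normc_conj c : normc c^* = normc c.
Proof. by case: c => a b /=; rewrite sqrrN. Qed.

Lemma normc_real x : normc x%:C%C = `|x|.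
Proof. by rewrite /= expr0n addr0 sqrtr_sqr. Qed.

Lemma normcX c n : normc (c ^+ n) = normc c ^+ n.
Proof. by elim: n => [|n IHn]; rewrite ?Normc.normc1// !exprS Normc.normcM IHn. Qed.

Lemma normc_eq1 c : `|c| = 1 -> normc c = 1.
Proof. by move=> /(congr1 (@complex.Re R)). Qed.

Lemma normc_sum (I : Type) (r : seq I) (P : pred I) (F : I -> R[i]) :
  normc (\sum_(i <- r | P i) F i) <= \sum_(i <- r | P i) normc (F i).
Proof.
elim/big_ind2: _ => [|x1 u y1 v lex ley|//]; first by rewrite Normc.normc0.
exact: le_trans (normcD _ _) (lerD lex ley).
Qed.

Lemma sqr_normcJ c : (normc c ^+ 2)%:C%C = c * c^*.
Proof. by rewrite -normCK norm_normc rmorphXn. Qed.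

Lemma sqr_normcE c : normc c ^+ 2 = complex.Re c ^+ 2 + complex.Im c ^+ 2.
Proof. by case: c => a b; rewrite /= sqr_sqrtr// addr_ge0 ?sqr_ge0. Qed.

Lemma normc_Re c : `|complex.Re c| <= normc c.
Proof.
rewrite -ler_sqr ?nnegrE ?normc_ge0// sqr_normcE real_normK ?num_real//.
by rewrite lerDl sqr_ge0.
Qed.

Lemma normc_nat n : normc (n%:R : R[i]) = n%:R.
Proof. by rewrite -(rmorph_nat (real_complex R)) normc_real ger0_norm. Qed.

End Modulus.

Lemma horner_algZ (R : comNzRingType) (A : algType R) (x : A) c (f : {poly R}) :
  horner_alg x (c *: f) = c *: horner_alg x f.
Proof. by rewrite -mul_polyC rmorphM /= horner_algC mulr_algl. Qed.

Lemma horner_alg_coef (R : comNzRingType) (A : algType R) (x : A) (f : {poly R}) n :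
  (size f <= n)%N -> horner_alg x f = \sum_(i < n) f`_i *: x ^+ i.
Proof.
move=> fn; have {1}-> : f = \sum_(i < n) f`_i *: 'X^i.
  rewrite -poly_def; apply/polyP => i; rewrite coef_poly; case: ltnP => // ni.
  by rewrite nth_default// (leq_trans fn).
by rewrite rmorph_sum /=; apply: eq_bigr => i _; rewrite horner_algZ rmorphXn /= horner_algX.
Qed.

Lemma horner_alg_scalar (R : comNzRingType) (x : R) (f : {poly R}) :
  horner_alg (x : R^o) f = f.[x].
Proof.
rewrite (horner_alg_coef _ (leqnn _)) horner_coef; apply: eq_bigr => i _.
by [].
Qed.

(** * Polynomials in a unitary and in its real part *)

Section UnitaryCalculus.
Variable R : realType.

(* u^d f(Re u) is a polynomial in u; stated for all algebras at once, so that it can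
   be read both in a C*-algebra and at the points of the circle. *)
Lemma laurent_poly (f : {poly R[i]}) : exists2 P : {poly R[i]},
  (size P <= (2 * size f).+1)%N &
  forall (A : algType R[i]) (u v : A), u * v = 1 -> v * u = 1 ->
    u ^+ size f * horner_alg (2^-1 *: (u + v)) f = horner_alg u P.
Proof.
pose d := size f.
(* With [y] the mean of [u] and [v], [u y = (u^2 + 1) / 2], hence [u^d y^i = (u y)^i u^(d - i)]. *)
exists (\sum_(i < d) f`_i *: ((2^-1 *: ('X^2 + 1)) ^+ i * 'X^(d - i))).
  apply: (leq_trans (size_sum _ _ _)); apply/bigmax_leqP => i _.
  apply: (leq_trans (size_scale_leq _ _)).
  apply: (leq_trans (size_polyMleq _ _)); rewrite size_polyXn addnS /=.
  have : (size ((2^-1 *: ('X^2 + 1) : {poly R[i]}) ^+ i) <= (2 * i).+1)%N.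
    apply: (leq_trans (size_poly_exp_leq _ _)); rewrite ltnS leq_mul2r.
    have : (size (2^-1 *: ('X^2 + 1) : {poly R[i]}) <= 3)%N.
      by apply: (leq_trans (size_scale_leq _ _)); rewrite size_XnaddC.
    by lia.
  have aux (m k : nat) : (k < d)%N -> (m <= (2 * k).+1)%N -> (m + (d - k) <= (2 * d).+1)%N by lia.
  exact: aux (ltn_ord i).
move=> A u v uv vu; set y := 2^-1 *: (u + v).
have uy : u * y = 2^-1 *: (u ^+ 2 + 1) by rewrite -scalerAr mulrDr uv expr2.
have cuy : GRing.comm u y by rewrite /GRing.comm /y -scalerAl -scalerAr mulrDr mulrDl uv vu.
rewrite (horner_alg_coef y (leqnn _)) mulr_sumr rmorph_sum /=; apply: eq_bigr => i _.
rewrite -scalerAr horner_algZ rmorphM !rmorphXn /= horner_algX; congr (_ *: _).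
rewrite horner_algZ rmorphD rmorphXn /= horner_algX rmorph1 -uy exprMn_comm//.
have cyu : GRing.comm (y ^+ i) (u ^+ (d - i)).
  exact: commr_sym (commrX _ (commr_sym (commrX _ (commr_sym cuy)))).
by rewrite -mulrA cyu mulrA -exprD subnKC// ltnW.
Qed.

Variable B : cstarAlgType R.
Implicit Types (x y u : B).

Lemma cnormZc c x : cnorm (c *: x) = normc c * cnorm x.
Proof. exact: cnormZ. Qed.

(** A Cauchy estimate: averaging over roots of unity bounds each coefficient by the supremum on the
    circle, and the triangle inequality adds up the [n] terms. *)
Lemma cnorm_horner_unitary u (P : {poly R[i]}) n (S : R) :
  cnorm u <= 1 -> (size P <= n)%N ->
  (forall l, `|l| = 1 -> normc P.[l] <= S) ->
  cnorm (horner_alg u P) <= n%:R * S.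
Proof.
move=> u1 Pn PS; have [l [l1 lE]] := root_average R n.
have coef k : (k < n)%N -> normc P`_k <= S.
  move=> kn; have n0 : 0 < n%:R :> R by rewrite ltr0n (leq_ltn_trans _ kn).
  have := lE _ (fun i => P`_i : R[i]^o) k kn => /= ->.
  rewrite [X in normc X]/(_ * _) Normc.normcM Normc.normcV normc_nat.
  rewrite mulrC ler_pdivrMr//; apply: le_trans (normc_sum _ _ _) _.
  rewrite mulr_natr -[n in _ *+ n]card_ord -sumr_const; apply: ler_sum => m _.
  rewrite [X in normc X]/(_ * _) Normc.normcM Normc.normcV normcX normc_eq1//.
  rewrite expr1n invr1 mul1r.
  apply: le_trans (PS _ (l1 m)); rewrite (horner_coef_wide _ Pn).
  by under eq_bigr do rewrite -[_ *: _]/(_ * _) mulrC.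
rewrite (horner_alg_coef _ Pn); apply: le_trans (cnorm_sum _ _ _) _.
rewrite mulr_natl -[n in _ *+ n]card_ord -sumr_const; apply: ler_sum => k _.
rewrite cnormZc -[leRHS]mulr1 ler_pM ?normc_ge0 ?cnorm_ge0 ?coef//.
by apply: le_trans (cnormX _ _) _; rewrite exprn_ile1 ?cnorm_ge0.
Qed.

Lemma horner_alg_comm (A : algType R[i]) (x : A) (f : {poly R[i]}) :
  GRing.comm x (horner_alg x f).
Proof. by rewrite /GRing.comm -[X in X * _ = _ * X](horner_algX x) -!rmorphM mulrC. Qed.

Lemma star_horner_alg (A : starAlgType R[i]) (x : A) (f : {poly R[i]}) :
  star (horner_alg x f) = horner_alg (star x) (map_poly Num.conj f).
Proof.
elim/poly_ind: f => [|f c IHf]; first by rewrite map_poly0 !rmorph0 star0.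
rewrite !(rmorphD, rmorphM) /= map_polyX map_polyC /=.
rewrite !horner_algC !horner_algX starD starM starZ star1 IHf.
by rewrite (horner_alg_comm (star x)).
Qed.

(** The Laurent polynomial gives the bound up to a factor linear in the degree; applied to high
    powers of the star-square of [f], it loses that factor. *)
Lemma cnorm_horner_cos u (f : {poly R[i]}) (S : R) :
  star u * u = 1 -> u * star u = 1 -> 0 <= S ->
  (forall x : R, -1 <= x <= 1 -> normc f.[x%:C%C] <= S) ->
  cnorm (horner_alg (2^-1 *: (u + star u)) f) <= S.
Proof.
move=> uu uu' S0 fS; set y := 2^-1 *: _.
have u1 := cnorm_unitary uu; have us1 : cnorm (star u) = 1 by rewrite cnormS.
have crude (g : {poly R[i]}) T :
    (forall x : R, -1 <= x <= 1 -> normc g.[x%:C%C] <= T) ->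
    cnorm (horner_alg y g) <= (2 * size g).+1%:R * T.
  move=> gT; have [P sP PE] := laurent_poly g.
  apply: (@le_trans _ _ (cnorm (horner_alg u P))); last first.
    apply: cnorm_horner_unitary; rewrite ?u1// => l l1.
    have ll : l * l^* = 1 by rewrite -normCK l1 expr1n.
    (* The identity of [laurent_poly] is read in the one-dimensional algebra, where [u] is a point
       of the circle and [y] its real part. *)
    have := PE R[i]^o l l^* ll; rewrite mulrC => /(_ ll).
    rewrite !horner_alg_scalar => <-.
    rewrite [X in normc X]/(_ * _) Normc.normcM normcX normc_eq1// expr1n mul1r.
    have -> : 2^-1 *: (l + l^*) = (complex.Re l)%:C%C.
      have e : 2^-1 * (2 * (complex.Re l)%:C%C) = (complex.Re l)%:C%C :> R[i].
        by rewrite mulKf// pnatr_eq0.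
      by rewrite -[RHS]e -addcJ.
    apply: gT; rewrite -ler_norml; apply: le_trans (normc_Re _) _.
    by rewrite normc_eq1.
  have {1}-> : horner_alg y g = star u ^+ size g * horner_alg u P.
    rewrite -(PE B u (star u) uu' uu) mulrA -exprMn_comm ?uu ?expr1n ?mul1r//.
    exact: etrans uu (esym uu').
  apply: le_trans (cnormM _ _) _.
  rewrite -[leRHS]mul1r ler_wpM2r ?cnorm_ge0//.
  by apply: le_trans (cnormX _ _) _; rewrite us1 expr1n.
have ysa : star y = y by rewrite starZ starD starK addrC fmorphV rmorph_nat.
(* Since [y] is self-adjoint, [F] at [y] is the star-square of [f] at [y]; on the reals [F] is the
   squared modulus of [f]. *)
pose F := map_poly Num.conj f * f.
have FE : horner_alg y F = star (horner_alg y f) * horner_alg y f.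
  by rewrite star_horner_alg ysa -rmorphM.
have FS (x : R) : -1 <= x <= 1 -> normc F.[x%:C%C] <= S ^+ 2.
  move=> /fS xS; rewrite hornerM.
  have -> : (map_poly Num.conj f).[x%:C%C] = (f.[x%:C%C])^*.
    by rewrite -[RHS]horner_map /= /Num.conj /= oppr0.
  by rewrite Normc.normcM normc_conj expr2 ler_pM ?normc_ge0.
rewrite -ler_sqr ?nnegrE ?cnorm_ge0// -cnorm_star -FE.
apply: (@power_trick _ _ _ (2 * (size F).+2)%:R) => [||n]; rewrite ?cnorm_ge0 ?sqr_ge0//.
rewrite -cnormX_sa; last by rewrite FE starM starK.
rewrite -rmorphXn /=.
have FnS (x : R) : -1 <= x <= 1 -> normc (F ^+ (2 ^ n)).[x%:C%C] <= (S ^+ 2) ^+ (2 ^ n).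
  by move=> /FS xS; rewrite horner_exp normcX lerXn2r ?nnegrE ?normc_ge0 ?sqr_ge0.
apply: le_trans (crude _ _ FnS) _.
rewrite ler_wpM2r ?exprn_ge0 ?sqr_ge0// -natrM ler_nat.
(* The size of [F ^+ (2 ^ n)] grows linearly in [2 ^ n], which brings the crude factor to the form
   that [power_trick] accepts. *)
have aux (a b c : nat) : (0 < c)%N -> (b <= (a.-1 * c).+1)%N ->
  ((2 * b).+1 <= 2 * a.+2 * c)%N by nia.
by apply: aux; rewrite ?expn_gt0// size_poly_exp_leq.
Qed.

End UnitaryCalculus.

(** * Self-adjoint elements as cosines, and functions of [star b * b] *)

Section SelfAdjoint.
Variables (R : realType) (B : cstarAlgType R).
Implicit Types (x y c d k u b : B) (r e : R).

Lemma unitary_of_squares c y : star c = c -> star y = y -> c * y = y * c ->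
  c * c + y * y = 1 -> exists u, [/\ star u * u = 1, u * star u = 1 &
    c = 2^-1 *: (u + star u)].
Proof.
move=> csa ysa cy cyE; exists (c + 'i *: y).
have us : star (c + 'i *: y) = c - 'i *: y.
  by rewrite starD starZ csa ysa conjCi scaleNr.
have ii : ('i : R[i]) * 'i = -1 by rewrite -expr2 sqrCi.
rewrite us; split.
- rewrite mulrDr !mulrBl -!(scalerAl, scalerAr) scalerA ii cy scaleN1r opprK.
  by rewrite -cyE addrA subrK.
- rewrite mulrBr !mulrDl -!(scalerAl, scalerAr) scalerA ii cy scaleN1r.
  by rewrite -cyE opprD addrA addrK opprK.
- have -> : c + 'i *: y + (c - 'i *: y) = 2 *: c.
    by rewrite addrACA subrr addr0 scaler_nat mulr2n.
  by rewrite scalerA mulVf ?scale1r ?pnatr_eq0.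
Qed.

Lemma cos_exists c : star c = c -> cnorm c < 1 -> exists u,
  [/\ star u * u = 1, u * star u = 1 & c = 2^-1 *: (u + star u)].
Proof.
move=> csa c1.
have [||y [ysa yE cy]] := @sqrt_exists _ _ (c * c).
- by rewrite starM csa.
- apply: le_lt_trans (cnormM _ _) _; rewrite -[ltRHS]mulr1.
  by rewrite ltr_pM ?cnorm_ge0.
apply: (@unitary_of_squares c y) => //; first by apply: cy; rewrite mulrA.
by rewrite yE addrC subrK.
Qed.

Lemma starZr r x : star (r%:C%C *: x) = r%:C%C *: star x.
Proof. by rewrite starZ /Num.conj /= oppr0. Qed.

Lemma cnormZr r x : cnorm (r%:C%C *: x) = `|r| * cnorm x.
Proof. by rewrite cnormZc normc_real. Qed.

(** Stands in for the positivity of [k * k]: if [k / r] is a cosine, the element is [r^2] times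
    [1 - x^2] at that cosine, and [1 - x^2] stays in [0, 1]. The triangle inequality alone would
    give [2 r^2]. *)
Lemma cnorm_sub_sqr k r : star k = k -> cnorm k < r ->
  cnorm ((r ^+ 2)%:C%C *: 1 - k * k) <= r ^+ 2.
Proof.
move=> ksa kr; have r0 : 0 < r := le_lt_trans (cnorm_ge0 _) kr.
have [||u [uu uu' kE]] := @cos_exists (r^-1%:C%C *: k).
- by rewrite starZr ksa.
- by rewrite cnormZr gtr0_norm ?invr_gt0// mulrC ltr_pdivrMr// mul1r.
have {kE} -> : (r ^+ 2)%:C%C *: 1 - k * k =
    horner_alg (2^-1 *: (u + star u)) ((r ^+ 2)%:C%C *: (1 - 'X * 'X)).
  have hE (a : R[i]) (v : B) : horner_alg v (a *: (1 - 'X * 'X)) = a *: (1 - v * v).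
    by rewrite horner_algZ rmorphB rmorph1 rmorphM /= horner_algX.
  rewrite hE -kE scalerBr.
  rewrite -scalerAl -scalerAr !scalerA -!rmorphM /= -mulrA.
  have -> : r ^+ 2 * (r^-1 * r^-1) = 1 by field; rewrite gt_eqF.
  by rewrite scale1r.
apply: cnorm_horner_cos => // [|x xb]; first exact: sqr_ge0.
rewrite hornerZ Normc.normcM normc_real ger0_norm ?sqr_ge0//.
have -> : (1 - 'X * 'X).[x%:C%C] = (1 - x * x)%:C%C.
  by rewrite !hornerE rmorphB rmorphM rmorph1.
by rewrite -[leRHS]mulr1 ler_wpM2l ?sqr_ge0// normc_real ler_norml; nra.
Qed.

(** A sum of squares is positive: after division by [m = g^2 + h^2 + e], its distance from 1 is at
    most [(g^2 + h^2) / m] by two uses of [cnorm_sub_sqr]. The shift by [e] makes this less than 1,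
    as [sqrt_exists] demands. *)
Lemma sqrt_sum_squares c d e : star c = c -> star d = d -> 0 < e ->
  exists k, [/\ star k = k, k * k = c * c + d * d + e%:C%C *: 1 &
    forall x, x * (c * c + d * d) = (c * c + d * d) * x -> x * k = k * x].
Proof.
move=> csa dsa e0.
have [cg dg] : cnorm c < cnorm c + 1 /\ cnorm d < cnorm d + 1 by rewrite !ltrDl ltr01.
move: cg dg (cnorm_ge0 c) (cnorm_ge0 d).
move: (cnorm c + 1) (cnorm d + 1) => g h cg dh c0 d0.
set q := c * c + d * d; set m := g ^+ 2 + h ^+ 2 + e.
have gh0 : 0 <= g ^+ 2 + h ^+ 2 by rewrite addr_ge0 ?sqr_ge0.
have m0 : 0 < m by rewrite /m; lra.
have qsa : star q = q by rewrite starD !starM csa dsa.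
pose w := m^-1%:C%C *: (q + e%:C%C *: 1).
have wE : 1 - w = m^-1%:C%C *:
    (((g ^+ 2)%:C%C *: 1 - c * c) + ((h ^+ 2)%:C%C *: 1 - d * d)).
  rewrite addrACA -opprD -/q -scalerDl -rmorphD /=.
  have m1 : 1 = m^-1%:C%C *: (m%:C%C *: 1) :> B.
    by rewrite scalerA -rmorphM mulVf ?gt_eqF// scale1r.
  rewrite [X in X - _]m1 -scalerBr; congr (_ *: _).
  by rewrite /m rmorphD /= [in LHS]scalerDl opprD addrACA subrr addr0.
have [||y [ysa yE cy]] := @sqrt_exists _ _ (1 - w).
- by rewrite starB star1 starZr starD qsa starZr star1.
- rewrite wE cnormZr gtr0_norm ?invr_gt0// mulrC ltr_pdivrMr// mul1r.
  apply: le_lt_trans (cnormD _ _) _.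
  by have := cnorm_sub_sqr csa cg; have := cnorm_sub_sqr dsa dh; rewrite /m; lra.
exists ((Num.sqrt m)%:C%C *: y); split.
- by rewrite starZr ysa.
- rewrite -scalerAl -scalerAr scalerA -rmorphM -expr2 sqr_sqrtr ?ltW//= yE.
  by rewrite subKr scalerA -rmorphM divff ?gt_eqF// scale1r.
- move=> x xq; rewrite -scalerAl -scalerAr cy// mulrBr mulrBl mulr1 mul1r.
  by rewrite -scalerAl -scalerAr mulrDr mulrDl xq -scalerAl -scalerAr mulr1 mul1r.
Qed.

(** Used to pass from bounds at [r *: x] with [r < 1] to a bound at [x]. *)
Lemma cnorm_scale_lip (f : {poly R[i]}) x : exists C : R, forall r, 0 <= r <= 1 ->
  cnorm (horner_alg (r%:C%C *: x) f - horner_alg x f) <= C * (1 - r).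
Proof.
elim/poly_ind: f => [|f c [C IH]].
  by exists 0 => r _; rewrite !rmorph0 subrr cnorm0 mul0r.
exists (C * cnorm x + cnorm (horner_alg x f) * cnorm x) => r r01.
rewrite !(rmorphD, rmorphM) /= !horner_algX !horner_algC opprD addrACA subrr addr0.
apply: le_trans (cnorm_triangle (horner_alg x f * (r%:C%C *: x)) _ _) _.
rewrite -mulrBl -mulrBr.
have -> : r%:C%C *: x - x = (r - 1)%:C%C *: x by rewrite rmorphB /= scalerBl scale1r.
have := cnormM (horner_alg (r%:C%C *: x) f - horner_alg x f) (r%:C%C *: x).
have := cnormM (horner_alg x f) ((r - 1)%:C%C *: x).
rewrite !cnormZr [`|r - 1|]distrC !ger0_norm; try lra.
have := IH r r01; have := cnorm_ge0 x; have := cnorm_ge0 (horner_alg x f).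
have := cnorm_ge0 (horner_alg (r%:C%C *: x) f - horner_alg x f).
set n1 := cnorm (_ - _); set n2 := cnorm x; set n3 := cnorm (horner_alg x f).
move=> p1 p3 p2 h; have [r0 r1] := andP r01.
have e1 : n1 * (r * n2) <= n1 * n2.
  by rewrite ler_wpM2l// ler_piMl.
by have := ler_wpM2r p2 h; lra.
Qed.

Lemma horner_alg_comp (A : algType R[i]) (x : A) (f g : {poly R[i]}) :
  horner_alg x (f \Po g) = horner_alg (horner_alg x g) f.
Proof.
elim/poly_ind: f => [|f c IH]; first by rewrite comp_poly0 !rmorph0.
rewrite comp_polyD comp_polyM comp_polyX comp_polyC.
by rewrite !(rmorphD, rmorphM) /= IH !horner_algX !horner_algC.
Qed.

Section Generator.
Variable b : B.
Hypothesis bE : star b * b + b * star b = 1.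
Let t := star b * b.
Let x := t + t - 1.

Lemma gen_comm (A : starAlgType R[i]) (a : A) : star a * a + a * star a = 1 ->
  (star a * a) * a = a * (1 - star a * a) /\
  star a * (star a * a) = (1 - star a * a) * star a.
Proof.
move=> /(canRL (addrK _)) e; split.
  by rewrite {1}e mulrBl mul1r mulrBr mulr1 mulrA.
by rewrite {1}e mulrBr mulr1 mulrBl mul1r mulrA.
Qed.

(* With z = 2 b^2, which is normal, x^2 + z z^* = 1, and z z^* is the sum of the
   squares of the real and imaginary parts of z. *)
Lemma gen_squares : exists c d, [/\ star c = c, star d = d &
  c * c + d * d + x * x = 1].
Proof.
pose p := b * b; pose q := star b * star b.
have bb : b * star b = 1 - t by rewrite -bE addrC addKr.
have [tb bt] := gen_comm bE; rewrite -/t in tb bt.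
have ps : star p = q by rewrite starM.
have qs : star q = p by rewrite starM !starK.
have pq : p * q = t * (1 - t).
  by rewrite /p /q -mulrA [b * (star b * _)]mulrA bb mulrA -tb -mulrA bb.
have qp : q * p = t * (1 - t).
  rewrite /p /q -mulrA [star b * (b * b)]mulrA -/t tb.
  by rewrite mulrA.
exists (p + q); exists ('i *: (p - q)); split.
- by rewrite starD ps qs addrC.
- by rewrite starZ starB ps qs conjCi scaleNr -scalerN opprB.
have ii : ('i : R[i]) * 'i = -1 by rewrite -expr2 sqrCi.
rewrite -scalerAl -scalerAr scalerA ii scaleN1r.
have -> : (p + q) * (p + q) - (p - q) * (p - q) = (t * (1 - t)) *+ 4.
  move: (t * (1 - t)) pq qp => m pq qp.
  have -> : (p + q) * (p + q) = (p * p + q * q) + m *+ 2.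
    by rewrite mulrDl !mulrDr pq qp [_ + q * q]addrC addrACA mulr2n.
  have -> : (p - q) * (p - q) = (p * p + q * q) - m *+ 2.
    by rewrite mulrBl !mulrBr pq qp opprB addrACA -opprD mulr2n.
  by rewrite opprD opprK addrACA subrr add0r -mulrnDr.
have h : ('X * (1 - 'X)) *+ 4 + ('X + 'X - 1) * ('X + 'X - 1) = 1 :> {poly R[i]}.
  by ring.
have := congr1 (horner_alg t) h.
rewrite rmorphD rmorphMn !rmorphM !rmorphB rmorphD rmorph1 /= horner_algX. by rewrite rmorph1.
Qed.

(** No bound on the norm of [x] is at hand, so [cos_exists] does not apply. Instead
    [1 - x^2 = c^2 + d^2], and a root [k] of [c^2 + d^2 + e] is the sine:
    [(r x)^2 + (r k)^2 = r^2 (1 + e)], where [e] is chosen to make this 1. *)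
Lemma gen_cos r : 0 < r < 1 -> exists u,
  [/\ star u * u = 1, u * star u = 1 & r%:C%C *: x = 2^-1 *: (u + star u)].
Proof.
move=> /andP[r0 r1]; have [c [d [csa dsa cdx]]] := gen_squares.
have e0 : 0 < (1 - r ^+ 2) / r ^+ 2.
  by rewrite divr_gt0 ?exprn_gt0// subr_gt0 exprn_ilt1// ltW.
have tsa : star t = t by rewrite starM starK.
have xsa : star x = x by rewrite starB starD tsa star1.
have [k [ksa kE kc]] := sqrt_sum_squares csa dsa e0.
have cdE : c * c + d * d = 1 - x * x by rewrite -cdx addrK.
apply: (@unitary_of_squares _ (r%:C%C *: k)).
- by rewrite starZr xsa.
- by rewrite starZr ksa.
- have xx (z : B) : z * (1 - z * z) = (1 - z * z) * z.
    by rewrite mulrBr mulrBl mulr1 mul1r mulrA.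
  by rewrite -!scalerAl -!scalerAr kc// cdE.
- rewrite -!scalerAl -!scalerAr !scalerA -rmorphM -scalerDr kE cdE /=.
  rewrite addrA [x * x + _]addrC subrK -[X in X + _]scale1r -scalerDl scalerA.
  rewrite -(rmorph1 (real_complex R)) -rmorphD -rmorphM /=.
  have -> : r * r * (1 + (1 - r ^+ 2) / r ^+ 2) = 1 by field; rewrite gt_eqF.
  by rewrite scale1r.
Qed.

(** The substitution [t = (1 + x) / 2] carries [-1, 1] to [0, 1]; the cosine bound holds at [r x]
    for [r < 1] and survives the limit. *)
Lemma cnorm_horner_gen (f : {poly R[i]}) (S : R) : 0 <= S ->
  (forall s : R, 0 <= s <= 1 -> normc f.[s%:C%C] <= S) ->
  cnorm (horner_alg t f) <= S.
Proof.
move=> S0 fS.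
pose g := f \Po (2^-1 *: (1 + 'X)).
have gE : horner_alg x g = horner_alg t f.
  rewrite horner_alg_comp horner_algZ rmorphD rmorph1 /= horner_algX.
  congr (horner_alg _ f); rewrite addrC subrK.
  have -> : t + t = 2 *: t by rewrite scaler_nat mulr2n.
  by rewrite scalerA mulVf ?pnatr_eq0// scale1r.
have [C hC] := cnorm_scale_lip g x.
have gS r : 0 < r < 1 -> cnorm (horner_alg (r%:C%C *: x) g) <= S.
  move=> /gen_cos[u [uu uu' ->]]; apply: cnorm_horner_cos => // y y1.
  rewrite horner_comp; have -> : (2^-1 *: (1 + 'X)).[y%:C%C] = (2^-1 * (1 + y))%:C%C.
    by rewrite !hornerE rmorphM rmorphD /= fmorphV rmorph_nat rmorph1.
  by apply: fS; lra.
rewrite -gE leNgt; apply/negP => Sg.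
set D := cnorm (horner_alg x g) - S; have D0 : 0 < D by rewrite subr_gt0.
(* Keeps [r = 1 - e] strictly between 0 and 1 and the Lipschitz error [|C| e] below the supposed
   excess [D]. *)
pose e := Num.min 2^-1 (D / (2 * (`|C| + 1))).
have C0 : 0 < `|C| + 1 by have := normr_ge0 C; lra.
have e0 : 0 < e by rewrite /e lt_min invr_gt0 ltr0n divr_gt0// mulr_gt0.
have e1 : e <= 2^-1 by rewrite /e ge_min lexx.
have e2 : e * (2 * (`|C| + 1)) <= D.
  by rewrite -ler_pdivlMr ?mulr_gt0// /e ge_min lexx orbT.
have h1 := gS (1 - e); have h2 := hC (1 - e).
have h3 := cnorm_triangle (horner_alg ((1 - e)%:C%C *: x) g) (horner_alg x g) 0.
rewrite !subr0 [X in _ <= X + _]cnormBC in h3.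
have h4 : C * (1 - (1 - e)) <= `|C| * e.
  by rewrite subKr ler_wpM2r ?ler_norm// ltW.
have := h1 _; have := h2 _; rewrite /D in e2 D0; move: (normr_ge0 C).
nra.
Qed.

End Generator.

End SelfAdjoint.

(* Norm one on self-adjoint elements (Re u goes to Re (psi u)); two halves give the
   factor 2, which is enough for continuity. *)
Lemma star_hom_le (R : realType) (A B : cstarAlgType R) (psi : A -> B) (x : A) :
  star_hom psi -> cnorm (psi x) <= 2 * cnorm x.
Proof.
move=> psiH.
have sa y : star y = y -> cnorm (psi y) <= cnorm y.
  move=> ysa; apply/ler_addgt0Pr => e e0.
  have r0 : 0 < cnorm y + e by rewrite ltr_wpDl ?cnorm_ge0.
  set r := cnorm y + e in r0 *.
  have [||u [uu uu' yE]] := @cos_exists _ _ (r^-1%:C%C *: y).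
  - by rewrite starZr ysa.
  - by rewrite cnormZr gtr0_norm ?invr_gt0// mulrC ltr_pdivrMr// mul1r /r ltrDl.
  have pu : cnorm (psi u) = 1.
    by apply: cnorm_unitary; rewrite -(star_homS psiH) -(star_homM psiH) uu (star_hom1 psiH).
  have : cnorm (psi (r^-1%:C%C *: y)) <= 1.
    rewrite yE (star_homZ psiH) (star_homD psiH) (star_homS psiH) cnorm_half.
    by have := cnormD (psi u) (star (psi u)); rewrite cnormS pu; lra.
  by rewrite (star_homZ psiH) cnormZr gtr0_norm ?invr_gt0// mulrC ler_pdivrMr// mul1r.
pose y := 2^-1 *: (x + star x); pose z := 2^-1 *: ('i *: (star x - x)).
have xE : x = y + 'i *: z.
  have e : 'i *: ('i *: (star x - x)) = x - star x.
    by rewrite scalerA -expr2 sqrCi scaleN1r opprB.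
  rewrite /y /z ['i *: (2^-1 *: _)]scalerA mulrC -scalerA e -scalerDr.
  rewrite addrACA subrr addr0; have -> : x + x = 2 *: x by rewrite scaler_nat mulr2n.
  by rewrite scalerA mulVf ?scale1r// pnatr_eq0.
have yh : cnorm y <= cnorm x.
  by rewrite cnorm_half; have := cnormD x (star x); rewrite cnormS; lra.
have normi : normc ('i : R[i]) = 1 by apply: normc_eq1; rewrite normCi.
have zh : cnorm z <= cnorm x.
  rewrite cnorm_half cnormZc normi mul1r.
  by have := cnormD (star x) (- x); rewrite cnormN cnormS; lra.
have ysa : star y = y.
  by rewrite starZ starD starK addrC fmorphV rmorph_nat.
have zsa : star z = z.
  by rewrite !starZ starB starK conjCi fmorphV rmorph_nat scaleNr -scalerN opprB.
have -> : psi x = psi y + 'i *: psi z by rewrite [in LHS]xE (star_homD psiH) [psi ('i *: z)](star_homZ psiH).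
apply: le_trans (cnormD _ _) _; rewrite cnormZc normi mul1r.
by have := sa _ ysa; have := sa _ zsa; lra.
Qed.

Lemma star_hom_horner (R : realType) (A B : starAlgType R[i]) (phi : A -> B) x f :
  star_hom phi -> phi (horner_alg x f) = horner_alg (phi x) f.
Proof.
move=> pH; elim/poly_ind: f => [|f c IHf]; first by rewrite !rmorph0 star_hom0.
rewrite !(rmorphD, rmorphM) /= !horner_algX !horner_algC.
by rewrite (star_homD pH) (star_homM pH) (star_homZ pH) (star_hom1 pH) IHf.
Qed.

(** * Evaluation of the presented algebra at a solution of the relation *)

Section Lift.
Variables (R : realType) (A : starAlgType R[i]) (a : A).
Hypothesis aE : star a * a + a * star a = 1.

Fixpoint nc_eval (x : starexp R) : A :=
  match x with
  | Sgen => a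
  | Sconst c => c%:A
  | Sadd x y => nc_eval x + nc_eval y
  | Smul x y => nc_eval x * nc_eval y
  | Sstar x => star (nc_eval x)
  end.

Lemma nc_evalP x y : sequiv x y -> nc_eval x = nc_eval y.
Proof.
elim=> //=.
- by move=> ? ? ? _ -> _ ->.
- by move=> ? ? ? ? _ -> _ ->.
- by move=> ? ? ? ? _ -> _ ->.
- by move=> ? ? _ ->.
- by move=> *; rewrite addrA.
- by move=> *; rewrite addrC.
- by move=> x'; rewrite scale0r add0r.
- by move=> x'; rewrite scale0r mul0r.
- by move=> *; rewrite mulrA.
- by move=> x'; rewrite scale1r mul1r.
- by move=> *; rewrite mulrDl.
- by move=> *; rewrite mulrDr.
- by move=> c d; rewrite scalerDl.
- by move=> c d; rewrite mulr_algl scalerA.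
- by move=> c x'; rewrite mulr_algl mulr_algr.
- by move=> x'; rewrite starK.
- by move=> *; rewrite starD.
- by move=> *; rewrite starM.
- by move=> c; rewrite starZ star1.
- by rewrite scale1r.
Qed.

Definition nc_lift (u : ncpoly R) : A := nc_eval (rep u).

Lemma nc_liftE x : nc_lift (cls x) = nc_eval x.
Proof. exact/nc_evalP/repP. Qed.

Lemma nc_lift_hom : star_hom nc_lift.
Proof.
split.
- move=> c; elim/nc_ind => x; elim/nc_ind => y.
  rewrite -[c *: cls x]/(nc_scale c _) nc_scaleE nc_mulE.
  by rewrite -[_ + _]/(nc_add _ _) nc_addE !nc_liftE /= mulr_algl.
- by rewrite nc_liftE /= scale1r.
- elim/nc_ind => x; elim/nc_ind => y.
  by rewrite -[_ * _]/(nc_mul _ _) nc_mulE !nc_liftE.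
- elim/nc_ind => x.
  by rewrite -[star _]/(nc_star _) nc_starE !nc_liftE.
Qed.

End Lift.

(** * The grading of the *-algebra *)

Section Grading.
Variable R : realType.
Local Notation NC := (ncpoly R).
Implicit Types (u v p : NC) (g q : {poly R[i]}).

Definition nc_gen : NC := cls (Sgen R).
Local Notation a := nc_gen.
Local Notation b := (star nc_gen).
Local Notation t := (star nc_gen * nc_gen).

Lemma nc_gen_rel : b * a + a * b = 1.
Proof.
rewrite -[star a]/(nc_star _) nc_starE.
rewrite -[_ + _]/(nc_add (nc_mul _ _) (nc_mul _ _)) !nc_mulE nc_addE.
exact/clsP/sequiv_rel.
Qed.

Lemma nc_gen_rel2 : a * b = 1 - t.
Proof. by rewrite -nc_gen_rel addrC addKr. Qed.

(** Moving either generator across a function of [t] reflects [t] to [1 - t], so one and the same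
    [g'] serves both. *)
Lemma horner_gen g : exists g', horner_alg t g * a = a * horner_alg t g' /\
  horner_alg t g * b = b * horner_alg t g'.
Proof.
have [ta bt] := gen_comm nc_gen_rel.
have tb : t * b = b * (1 - t) by rewrite mulrBr mulr1 bt mulrBl mul1r subKr.
exists (g \Po (1 - 'X)).
rewrite horner_alg_comp rmorphB rmorph1 /= horner_algX.
have comm c : t * c = c * (1 - t) -> horner_alg t g * c = c * horner_alg (1 - t) g.
  move=> tc; elim/poly_ind: g => [|f d IHf]; first by rewrite !rmorph0 mul0r mulr0.
  rewrite !(rmorphD, rmorphM) /= !horner_algX !horner_algC mulrDl mulrDr.
  by rewrite -mulrA tc mulrA IHf mulrA mulr_algl mulr_algr.
by split; apply: comm.
Qed.

Lemma horner_genX g k : exists g',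
  horner_alg t g * a ^+ k = a ^+ k * horner_alg t g' /\
  horner_alg t g * b ^+ k = b ^+ k * horner_alg t g'.
Proof.
elim: k g => [|k IHk] g; first by exists g; rewrite !expr0 !mul1r !mulr1.
have [g1 [e1 e2]] := horner_gen g; have [g2 [f1 f2]] := IHk g1.
exists g2; rewrite !exprS !mulrA e1 e2; split.
  by rewrite -[LHS]mulrA f1 mulrA.
by rewrite -[LHS]mulrA f2 mulrA.
Qed.

(* Degree k - d: the subtractions are truncated, so at most one of the two powers is
   nontrivial. *)
Definition homog (k d : nat) u := exists g,
  u = a ^+ (k - d) * b ^+ (d - k) * horner_alg t g.

Lemma homog0 k d : homog k d 0.
Proof. by exists 0; rewrite rmorph0 mulr0. Qed.

Lemma homogD k d u v : homog k d u -> homog k d v -> homog k d (u + v).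
Proof. by move=> [g ->] [h ->]; exists (g + h); rewrite rmorphD mulrDr. Qed.

Lemma homogZ k d c u : homog k d u -> homog k d (c *: u).
Proof. by move=> [g ->]; exists (c *: g); rewrite horner_algZ scalerAr. Qed.

Lemma homog_gen k d u : homog k d u -> homog k.+1 d (a * u).
Proof.
move=> [g ->]; have [dk|kd] := leqP d k.
  have e1 : (d - k = 0)%N by apply/eqP.
  have e2 : (d - k.+1 = 0)%N by apply/eqP; rewrite subn_eq0 leqW.
  by exists g; rewrite subSn// e1 e2 !mulrA -exprS.
have e1 : (k - d = 0)%N by apply/eqP; rewrite subn_eq0 ltnW.
have e2 : (k.+1 - d = 0)%N by apply/eqP; rewrite subn_eq0.
have e3 : (d - k = (d - k.+1).+1)%N by rewrite -subSn// subSS.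
(* The new [a] meets a [b]; their product [1 - t] is moved to the right, past the remaining powers
   of [b]. *)
have [q [_ qE]] := horner_genX (1 - 'X) (d - k.+1).
have {}qE : (a * b) * b ^+ (d - k.+1) = b ^+ (d - k.+1) * horner_alg t q.
  by rewrite -qE rmorphB rmorph1 /= horner_algX -nc_gen_rel2.
exists (q * g); rewrite e1 e2 e3 expr0 !mul1r rmorphM /= [RHS]mulrA -qE exprS.
by rewrite !mulrA.
Qed.

Lemma homog_star_gen k d u : homog k d u -> homog k d.+1 (b * u).
Proof.
move=> [g ->]; have [kd|dk] := leqP k d.
  have e1 : (k - d = 0)%N by apply/eqP.
  have e2 : (k - d.+1 = 0)%N by apply/eqP; rewrite subn_eq0 leqW.
  by exists g; rewrite subSn// e1 e2 expr0 !mul1r mulrA -exprS.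
have e1 : (d - k = 0)%N by apply/eqP; rewrite subn_eq0 ltnW.
have e2 : (d.+1 - k = 0)%N by apply/eqP; rewrite subn_eq0.
have e3 : (k - d = (k - d.+1).+1)%N by rewrite -subSn// subSS.
have [q [qE _]] := horner_genX 'X (k - d.+1).
have {}qE : (b * a) * a ^+ (k - d.+1) = a ^+ (k - d.+1) * horner_alg t q.
  by rewrite -qE /= horner_algX.
exists (q * g); rewrite e1 e2 e3 expr0 !mulr1 rmorphM /= [RHS]mulrA -qE exprS.
by rewrite !mulrA.
Qed.

(** The product is nested: the powers of [b] and [a], then those of [a] and [b], surround a
    polynomial in [t]. Each innermost pair is absorbed into it as a factor [t] or [1 - t], up to the
    reflection. *)
Lemma star_homogM k d u : homog k d u -> exists q, star u * u = horner_alg t q.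
Proof.
have conjb i g : exists g', b ^+ i * horner_alg t g * a ^+ i = horner_alg t g'.
  elim: i g => [|i IHi] g; first by exists g; rewrite mul1r mulr1.
  have [g1 [e1 _]] := horner_gen g; have [g2 e2] := IHi ('X * g1).
  exists g2; rewrite -e2 rmorphM /= horner_algX exprSr exprS -!mulrA.
  by congr (_ * (_ * _)); rewrite [LHS]mulrA e1 mulrA.
have conja i g : exists g', a ^+ i * horner_alg t g * b ^+ i = horner_alg t g'.
  elim: i g => [|i IHi] g; first by exists g; rewrite mul1r mulr1.
  have [g1 [_ e1]] := horner_gen g; have [g2 e2] := IHi ((1 - 'X) * g1).
  exists g2; rewrite -e2 rmorphM rmorphB rmorph1 /= horner_algX exprSr exprS -!mulrA.
  by congr (_ * _); rewrite [horner_alg t g * _]mulrA e1 -nc_gen_rel2 !mulrA.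
have tsa : star t = t by rewrite starM starK.
move=> [g ->]; rewrite !starM !starX starK star_horner_alg tsa.
have [g1 e1] := conjb (k - d)%N 1; have [g2 e2] := conja (d - k)%N g1.
exists (map_poly Num.conj g * (g2 * g)); rewrite !rmorphM /= -e2 -e1 rmorph1 mulr1.
by rewrite !mulrA.
Qed.

(** Degrees from [-d] to [d], with the index shifted by [d] to stay in the naturals. The number
    [2 d + 1] of components is the factor lost in [filt_bound]. *)
Definition filt d u := exists2 v : nat -> NC,
  forall k, homog k d (v k) & u = \sum_(k < (2 * d).+1) v k.

Lemma filtD d u v : filt d u -> filt d v -> filt d (u + v).
Proof.
move=> [f hf ->] [g hg ->]; exists (fun k => f k + g k); last by rewrite big_split.
by move=> k; apply: homogD.
Qed.

Lemma filtZ d c u : filt d u -> filt d (c *: u).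
Proof.
move=> [f hf ->]; exists (fun k => c *: f k); last by rewrite scaler_sumr.
by move=> k; apply: homogZ.
Qed.

(** The window grows by one degree on each side; [s] is 0, 1 or 2 according to whether the
    components move down, stay or move up by one degree. *)
Lemma filt_shift d s u (f : nat -> NC) : (s <= 2)%N ->
  (forall k, homog (s + k) d.+1 (f k)) -> u = \sum_(k < (2 * d).+1) f k ->
  filt d.+1 u.
Proof.
move=> s2 hf ->.
pose F k := if (s <= k < s + (2 * d).+1)%N then f (k - s)%N else 0.
exists F => [k|].
  rewrite /F; case: ifP => [/andP[sk _]|_]; last exact: homog0.
  by have := hf (k - s)%N; rewrite subnKC.
rewrite -(big_mkord xpredT f) -(big_mkord xpredT F).
have le1 : (s <= (2 * d.+1).+1)%N by rewrite (leq_trans s2).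
have le2 : (s + (2 * d).+1 <= (2 * d.+1).+1)%N by rewrite mulnS addnS ltnS leq_add2r.
rewrite (big_cat_nat (leq0n s) le1) /=.
rewrite [X in X + _]big_nat_cond [X in X + _]big1 ?add0r; last first.
  by move=> i /andP[/andP[_ is_]] _; rewrite /F leqNgt is_.
rewrite (big_cat_nat (leq_addr (2 * d).+1 s) le2) /=.
rewrite [X in _ + X]big_nat_cond [X in _ + X]big1 ?addr0; last first.
  by move=> i /andP[/andP[si _]] _; rewrite /F [(i < _)%N]ltnNge si andbF.
rewrite -{1}[s]add0n big_addn addKn [LHS]big_nat [RHS]big_nat.
apply: eq_bigr => i /andP[_ il].
by rewrite /F leq_addl /= addnC ltn_add2l il addKn.
Qed.

Lemma filtS d u : filt d u -> filt d.+1 u.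
Proof. by move=> [f hf ->]; apply: (@filt_shift _ 1 _ f). Qed.

Lemma filt_gen d u : filt d u -> filt d.+1 (a * u).
Proof.
move=> [f hf ->]; apply: (@filt_shift _ 2 _ (fun k => a * f k)) => //.
  by move=> k; have /homog_gen := hf k.
by rewrite mulr_sumr.
Qed.

Lemma filt_star_gen d u : filt d u -> filt d.+1 (b * u).
Proof.
move=> [f hf ->]; apply: (@filt_shift _ 0 _ (fun k => b * f k)) => //.
  by move=> k; have /homog_star_gen := hf k.
by rewrite mulr_sumr.
Qed.

Lemma filt_addl m d u : filt d u -> filt (m + d) u.
Proof. by move=> h; elim: m => // m IHm; apply: filtS. Qed.

(** The induction treats [cls x] and its star together because [Sstar] exchanges them. That [m] is
    independent of [d] and [u] is what makes degrees additive under products. *)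
Lemma filt_cls (x : starexp R) : exists m,
  (forall d u, filt d u -> filt (m + d) (cls x * u)) /\
  (forall d u, filt d u -> filt (m + d) (star (cls x) * u)).
Proof.
elim: x => [|c|x [m [hx hx']] y [n [hy hy']]|x [m [hx hx']] y [n [hy hy']]|x [m [hx hx']]].
- by exists 1%N; split=> d u; [apply: filt_gen|apply: filt_star_gen].
- have cE e : cls (Sconst e) = e%:A :> NC.
    by rewrite -[RHS]/(nc_scale _ (nc_const 1)) nc_scaleE nc_mulr1.
  by exists 0%N; split=> d u; rewrite cE ?starZ ?star1 mulr_algl; apply: filtZ.
- have -> : cls (Sadd x y) = cls x + cls y by rewrite -nc_addE.
  exists (m + n)%N; split=> d u h; rewrite ?starD mulrDl; apply: filtD.
  + by rewrite addnAC addnC; apply/filt_addl/hx.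
  + by rewrite -addnA; apply/filt_addl/hy.
  + by rewrite addnAC addnC; apply/filt_addl/hx'.
  + by rewrite -addnA; apply/filt_addl/hy'.
- have -> : cls (Smul x y) = cls x * cls y by rewrite -nc_mulE.
  exists (m + n)%N; split=> d u h; rewrite ?starM -mulrA.
    by rewrite -addnA; apply/hx/hy.
  by rewrite -addnA addnCA; apply/hy'/hx'.
- have -> : cls (Sstar x) = star (cls x) by rewrite -nc_starE.
  by exists m; rewrite starK.
Qed.

Lemma filt_expr p : exists m, forall n, filt (n * m) (p ^+ n).
Proof.
elim/nc_ind: p => x; have [m [hm _]] := filt_cls x.
exists m; elim=> [|n IHn]; last by rewrite mulSn exprS; apply: hm.
exists (fun k => if k is 0 then 1 else 0); last by rewrite muln0 big_ord1.
by case=> [|k]; [exists 1; rewrite rmorph1 !mulr1|exact: homog0].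
Qed.

End Grading.

(** * The disk and the C*-norm of A_1 *)

Section Disk.
Variable R : realType.
Local Notation disk := (@closed_disk R).
Local Notation M2 := 'M[R[i]]_2.

Definition dval (z : disk) : R[i] := set_val z.

Lemma normc_le1 (c : R[i]) : (`|c| <= 1) = (normc c <= 1).
Proof. by rewrite norm_normc -[RHS]lecR rmorph1. Qed.

Lemma dvalP z : normc (dval z) <= 1.
Proof. by have := set_valP z; rewrite /closed_disk /= normc_le1. Qed.

Lemma disk_of_subproof (c : R[i]) : normc c <= 1 -> c \in @closed_disk R.
Proof. by move=> c1; apply/mem_set; rewrite /closed_disk /= normc_le1. Qed.

Definition disk_of (c : R[i]) (h : normc c <= 1) : disk :=
  exist _ c (disk_of_subproof h).

Lemma dvalK c h : dval (@disk_of c h) = c.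
Proof. by []. Qed.

Lemma dval_inj : injective dval.
Proof. exact: val_inj. Qed.

Lemma complex_nbhsP (c : R[i]) (A : set R[i]) : nbhs c A <->
  exists2 e : R, 0 < e & forall d, normc (d - c) < e -> A d.
Proof.
split=> [/nbhs_ballP[e /= e0 eA]|[e e0 eA]].
  have eE : e = (complex.Re e)%:C%C by rewrite RRe_real// gtr0_real.
  exists (complex.Re e); first by rewrite -ltcR -eE.
  by move=> d dc; apply: eA; rewrite -ball_normE /ball_ /= eE distrC norm_normc ltcR.
apply/nbhs_ballP; exists e%:C%C; first by rewrite /= ltcR.
move=> d; rewrite -ball_normE /ball_ /= distrC norm_normc ltcR; exact: eA.
Qed.

Lemma disk_nbhsP (z : disk) (A : set disk) : nbhs z A <->
  exists2 e : R, 0 < e & forall w, normc (dval w - dval z) < e -> A w.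
Proof.
split.
  move=> [B [[C oC <-] Cz] BA].
  have /complex_nbhsP[e e0 eC] : nbhs (dval z) C by apply: open_nbhs_nbhs.
  by exists e => // w /eC Cw; apply: BA.
move=> [e e0 eA].
have : nbhs (dval z) [set d | normc (d - dval z) < e] by apply/complex_nbhsP; exists e.
rewrite nbhsE => -[C [oC Cz] Ce].
exists (set_val @^-1` C); split; first by exists C.
  exact: Cz.
by move=> w /Ce; exact: eA.
Qed.

Lemma disk_continuousP (f : disk -> M2) : continuous f <->
  forall z (e : R), 0 < e -> exists2 d : R, 0 < d &
    forall w, normc (dval w - dval z) < d -> forall i j, normc (f w i j - f z i j) < e.
Proof.
split=> [fc z e e0|h].
  suff : \forall w \near z, forall i j, normc (f w i j - f z i j) < e.
    by move/disk_nbhsP.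
  apply: (@filter_forall _ _ _ _ (nbhs_filter z)) => i; apply: filter_forall => j.
  have h : nbhs (f z i j) [set d | normc (d - f z i j) < e].
    by apply/complex_nbhsP; exists e.
  exact: (mx_entry_continuous fc h).
apply: mx_continuousP => i j z A /complex_nbhsP[e e0 eA].
by apply/disk_nbhsP; have [d d0 hd] := h z e e0; exists d => // w /hd/(_ i j)/eA.
Qed.

Lemma normc_le_ReIm (c : R[i]) : normc c <= `|complex.Re c| + `|complex.Im c|.
Proof.
rewrite -ler_sqr ?nnegrE ?normc_ge0 ?addr_ge0// sqr_normcE.
rewrite -(real_normK (num_real (complex.Re c))) -(real_normK (num_real (complex.Im c))).
by have := normr_ge0 (complex.Re c); have := normr_ge0 (complex.Im c); nra.
Qed.

Lemma normc_Im (c : R[i]) : `|complex.Im c| <= normc c.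
Proof.
rewrite -ler_sqr ?nnegrE ?normc_ge0// sqr_normcE real_normK ?num_real//.
by rewrite lerDr sqr_ge0.
Qed.

(* Compactness of the disk, for a family of properties that is monotone in n. *)
Lemma disk_cover (P : nat -> disk -> Prop) :
  (forall m n z, (m <= n)%N -> P m z -> P n z) ->
  (forall z, exists n, exists2 d : R, 0 < d &
     forall w, normc (dval w - dval z) < d -> P n w) ->
  exists n, forall z, P n z.
Proof.
move=> Pmono Ploc.
(* Compactness is borrowed from the square; [Q] says nothing at points outside the disk. *)
have cK : compact (`[-1, 1]%classic `*` `[-1, 1]%classic : set (R * R)).
  by apply: compact_setX; exact: segment_compact.
have sq z : (`[-1, 1]%classic `*` `[-1, 1]%classic) (complex.Re (dval z), complex.Im (dval z)).
  have := dvalP z; have := normc_Re (dval z); have := normc_Im (dval z).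
  by rewrite /= !in_itv /= -!ler_norml; split; lra.
pose Q n (p : R * R) := forall z, dval z = Complex p.1 p.2 -> P n z.
have [|N _ hN] := (compact_near_coveringP _).1 cK nat \oo Q _; last first.
  exists N => z; apply: (hN N (leqnn N) _ (sq z)) => /=; by case: (dval z).
case=> x y _.
have close e : 0 < e -> nbhs (x, y) [set p : R * R |
    normc (Complex p.1 p.2 - Complex x y) < e].
  move=> e0; have e2 : 0 < e / 2 by rewrite divr_gt0.
  apply/nbhs_ballP; exists (e / 2) => // -[x' y'] [h1 h2].
  apply: le_lt_trans (normc_le_ReIm (Complex x' y' - Complex x y)) _.
  move: h1 h2; rewrite -!ball_normE /ball_ /= [`|x - _|]distrC [`|y - _|]distrC; lra.
have [xy1|xy1] := leP (normc (Complex x y)) 1.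
  have [n [d d0 hd]] := Ploc (disk_of xy1).
  exists ([set p : R * R | normc (Complex p.1 p.2 - Complex x y) < d], [set m | (n <= m)%N]).
    by split=> /=; [exact: close|exists n].
  move=> [p m] [h nm] z zp; apply: (Pmono _ _ _ nm); apply: hd.
  by rewrite dvalK zp.
(* A ball around an outside point that misses the disk, so that [Q] holds on it vacuously. *)
exists ([set p : R * R | normc (Complex p.1 p.2 - Complex x y) < normc (Complex x y) - 1], setT).
  by split; [apply: close; rewrite subr_gt0|exact: filterT].
move=> [p m] [h _] z zp; have := dvalP z; rewrite zp => zp1.
have := normcD (Complex p.1 p.2) (Complex x y - Complex p.1 p.2).
rewrite [X in normc X <= _]addrC subrK [X in _ + X]normcB; move: h zp1; rewrite /mkset/=; lra.
Qed.

Lemma disk_bounded (f : disk -> M2) : continuous f ->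
  exists K : R, forall z i j, normc (f z i j) <= K.
Proof.
move=> /disk_continuousP fc.
have [|z|n hn] := @disk_cover (fun n z => forall i j, normc (f z i j) <= n%:R).
- by move=> m n z mn h i j; apply: le_trans (h i j) _; rewrite ler_nat.
- have [d d0 hd] := fc z 1 ltr01.
  pose S := \sum_i \sum_j normc (f z i j).
  exists (Num.truncn (S + 1)).+1; exists d => // w /hd h i j.
  apply: (@le_trans _ _ (S + 1)); last exact/ltW/truncnS_gt.
  have Sij : normc (f z i j) <= S.
    rewrite /S (bigD1 i)//= (bigD1 j)//= -addrA lerDl addr_ge0 ?sumr_ge0// => *.
      exact: normc_ge0.
    by rewrite sumr_ge0// => *; exact: normc_ge0.
  have := normcD (f z i j) (f w i j - f z i j); rewrite addrC subrK.
  by have := h i j; lra.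
by exists n%:R => z i j; exact: hn.
Qed.

End Disk.

(* Locked: unfolding these norms makes unification diverge. *)
HB.lock Definition vnorm (R : realType) n (v : 'rV[R[i]]_n) : R :=
  complex.Re (sqrtC (dotmx v v)).
Canonical vnorm_unlockable := Unlockable vnorm.unlock.

HB.lock Definition disk_norm (R : realType) (f : @closed_disk R -> 'M[R[i]]_2) : R :=
  sup [set x | exists z v, vnorm v <= 1 /\ x = vnorm (v *m f z)].
Canonical disk_norm_unlockable := Unlockable disk_norm.unlock.

(** * The Euclidean norm on row vectors *)

Section VectorNorm.
Variable (R : realType) (n : nat).
Local Open Scope sesquilinear_scope.
Implicit Types (u v : 'rV[R[i]]_n) (M : 'M[R[i]]_n).

Lemma vnormE v : (vnorm v)%:C%C = sqrtC (dotmx v v).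
Proof.
by rewrite unlock RRe_real// ger0_real// sqrtC_ge0 (@dnorm_ge0 _ _ (@dotmx _ n)).
Qed.

Lemma vnorm_ge0 v : 0 <= vnorm v.
Proof. by rewrite -lecR vnormE sqrtC_ge0 (@dnorm_ge0 _ _ (@dotmx _ n)). Qed.

Lemma sqr_vnorm v : (vnorm v ^+ 2)%:C%C = dotmx v v.
Proof. by rewrite rmorphXn /= vnormE sqrtCK. Qed.

Lemma vnormD u v : vnorm (u + v) <= vnorm u + vnorm v.
Proof.
by rewrite -lecR rmorphD /= !vnormE (@triangle_lerif _ _ (@dotmx _ n)).
Qed.

Lemma dotmx_le u v : normc (dotmx u v) <= vnorm u * vnorm v.
Proof.
rewrite -lecR rmorphM /= !vnormE -norm_normc.
exact: (@CauchySchwarz_sqrt _ _ (@dotmx _ n)).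
Qed.

Lemma dotmx_mulmx u v M : dotmx (u *m M) v = dotmx u (v *m M^t*).
Proof. by rewrite !dotmxE trmx_mul map_mxM /= trmxCK mulmxA. Qed.

Lemma vnormZ c v : vnorm (c *: v) = normc c * vnorm v.
Proof.
apply: (@complexI R); rewrite rmorphM /= !vnormE -norm_normc.
rewrite -(sqrCK (normr_ge0 c)) -rootCMl ?exprn_ge0//.
by congr sqrtC; exact: (@dnormZ _ _ (@dotmx _ n)).
Qed.

Lemma vnorm_eq0 v : vnorm v = 0 -> v = 0.
Proof.
move=> v0; apply/eqP; have <- := @dnorm_eq0 _ _ (@dotmx _ n) v.
by rewrite -[X in X == 0]sqr_vnorm v0 expr0n.
Qed.

Lemma vnorm0 : vnorm (0 : 'rV[R[i]]_n) = 0.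
Proof. by rewrite -(scale0r 0) vnormZ Normc.normc0 mul0r. Qed.

Lemma vnorm_sum (I : Type) (r : seq I) (P : pred I) (F : I -> 'rV[R[i]]_n) :
  vnorm (\sum_(i <- r | P i) F i) <= \sum_(i <- r | P i) vnorm (F i).
Proof.
elim/big_ind2: _ => [|x1 u y1 v lex ley|//]; first by rewrite vnorm0.
exact: le_trans (vnormD _ _) (lerD lex ley).
Qed.

Lemma vnorm_unitary v M : M *m M^t* = 1%:M -> vnorm (v *m M) = vnorm v.
Proof.
by move=> MM; rewrite unlock dotmx_mulmx -mulmxA MM mulmx1.
Qed.

Lemma vnorm_entry v j : normc (v 0 j) <= vnorm v.
Proof.
rewrite -ler_sqr ?nnegrE ?normc_ge0 ?vnorm_ge0// -lecR sqr_vnorm sqr_normcJ.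
rewrite dotmxE mxE (bigD1 j)//= !mxE lerDl sumr_ge0// => i _.
by rewrite !mxE -normCK exprn_ge0.
Qed.

Lemma vnorm_delta j : vnorm (delta_mx 0 j : 'rV[R[i]]_n) = 1.
Proof.
rewrite unlock dotmxE mxE (bigD1 j)//= !mxE !eqxx big1 ?addr0 => [|i /negbTE ij].
  by rewrite conjC1 mulr1 sqrtC1.
by rewrite !mxE ij andbF mul0r.
Qed.

Lemma vnorm_le v : vnorm v <= \sum_j normc (v 0 j).
Proof.
rewrite {1}[v]row_sum_delta; apply: le_trans (vnorm_sum _ _ _) _.
by apply: ler_sum => j _; rewrite vnormZ vnorm_delta mulr1.
Qed.

Lemma entry_le M K i j : (forall v, vnorm (v *m M) <= K * vnorm v) ->
  normc (M i j) <= K.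
Proof.
move=> /(_ (delta_mx 0 i)); rewrite vnorm_delta mulr1 -rowE => h.
by apply: le_trans h; have := vnorm_entry (row i M) j; rewrite mxE.
Qed.

(** Crude on purpose: at size 2 the constant is 4, the origin of the tolerances [e / 4] and [e / 8]
    used for entries later on. *)
Lemma vnorm_mul_le M K v : (forall i j, normc (M i j) <= K) ->
  vnorm (v *m M) <= n%:R * n%:R * K * vnorm v.
Proof.
move=> MK; apply: le_trans (vnorm_le _) _.
have h j : normc ((v *m M) 0 j) <= n%:R * K * vnorm v.
  rewrite mxE; apply: le_trans (normc_sum _ _ _) _.
  rewrite -mulrA mulr_natl -[n in _ *+ n]card_ord -sumr_const; apply: ler_sum => i _.
  by rewrite Normc.normcM mulrC ler_pM ?normc_ge0 ?vnorm_entry.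
rewrite -!mulrA mulr_natl -[n in _ *+ n]card_ord -sumr_const.
by apply: ler_sum => j _; rewrite mulrA.
Qed.

End VectorNorm.

Lemma complex_complete (R : realType) (c : nat -> R[i]) :
  (forall e : R, 0 < e -> exists N : nat, forall m n : nat,
     (N <= m)%N -> (N <= n)%N -> normc (c m - c n) < e) ->
  exists l, forall e : R, 0 < e -> exists N : nat, forall n : nat,
     (N <= n)%N -> normc (c n - l) < e.
Proof.
move=> cC.
have real (x : nat -> R) : (forall m n, `|x m - x n| <= normc (c m - c n)) ->
    exists l, forall e : R, 0 < e -> exists N : nat, forall n : nat,
    (N <= n)%N -> `|x n - l| < e.
  move=> xc; have : cvg (x @ \oo).
    apply/cauchy_cvgP/cauchy_exP => e e0; have [N hN] := cC e e0.
    exists (x N), N => // n /= Nn; rewrite -ball_normE /ball_ /=.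
    by apply: le_lt_trans (xc _ _) _; apply: hN.
  move=> /cvgrPdist_lt h; exists (lim (x @ \oo)) => e /h[N _ hN].
  by exists N => n /hN; rewrite distrC.
have [|a ha] := real (fun n => complex.Re (c n)).
  by move=> m n; have := normc_Re (c m - c n); case: (c m) (c n) => ? ? [].
have [|b hb] := real (fun n => complex.Im (c n)).
  by move=> m n; have := normc_Im (c m - c n); case: (c m) (c n) => ? ? [].
exists (Complex a b) => e e0; have e2 : 0 < e / 2 by rewrite divr_gt0.
have [N hN] := ha _ e2; have [N' hN'] := hb _ e2.
exists (maxn N N') => n; rewrite geq_max => /andP[/hN h1 /hN' h2].
apply: le_lt_trans (normc_le_ReIm _) _; move: h1 h2.
by case: (c n) => ? ? /=; lra.
Qed.

(** * The supremum of operator norms as a complete C*-norm *)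

Section DiskNorm.
Variable R : realType.
Local Notation disk := (@closed_disk R).
Local Notation M2 := 'M[R[i]]_2.
Implicit Types (f : disk -> M2) (u : A1 R).
Local Open Scope sesquilinear_scope.

Lemma disk_norm_le f K : 0 <= K ->
  (forall z v, vnorm (v *m f z) <= K * vnorm v) -> disk_norm f <= K.
Proof.
move=> K0 fK; rewrite unlock; apply: ge_sup.
  by exists (vnorm (0 *m f (circle_pt 0))), (circle_pt 0), 0; rewrite vnorm0.
move=> _ [z [v [v1 ->]]]; apply: le_trans (fK z v) _.
by rewrite -[leRHS]mulr1 ler_wpM2l.
Qed.

Lemma disk_norm_ub f z v : continuous f -> vnorm (v *m f z) <= disk_norm f * vnorm v.
Proof.
move=> /disk_bounded[K fK].
have [->|v0] := eqVneq v 0; first by rewrite mul0mx vnorm0 mulr0.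
have vp : 0 < vnorm v.
  by rewrite lt_def vnorm_ge0 andbT; apply: contra v0 => /eqP/vnorm_eq0 ->.
rewrite -ler_pdivrMr// [disk_norm]unlock; apply: ub_le_sup.
  exists (2%:R * 2%:R * K) => _ [y [w [w1 ->]]].
  apply: le_trans (vnorm_mul_le _ (fK y)) _.
  rewrite -[leRHS]mulr1 ler_wpM2l// !mulr_ge0//.
  by apply: le_trans (fK y 0 0); exact: normc_ge0.
have nv : normc ((vnorm v)^-1%:C%C : R[i]) = (vnorm v)^-1.
  by rewrite normc_real gtr0_norm// invr_gt0.
exists z, ((vnorm v)^-1%:C%C *: v); rewrite -scalemxAl !vnormZ nv; split.
  by rewrite mulVf// gt_eqF.
by rewrite mulrC.
Qed.

Definition A1_norm u : R := disk_norm (A1val u).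

Lemma A1_norm_ub u z v : vnorm (v *m A1val u z) <= A1_norm u * vnorm v.
Proof. by apply: disk_norm_ub; have [] := A1valP u. Qed.

Lemma A1_norm_ge0 u : 0 <= A1_norm u.
Proof.
have := A1_norm_ub u (circle_pt 0) (delta_mx 0 0); rewrite vnorm_delta mulr1.
exact/le_trans/vnorm_ge0.
Qed.

Lemma A1_norm_entry u z i j : normc (A1val u z i j) <= A1_norm u.
Proof. by apply: entry_le => v; apply: A1_norm_ub. Qed.

Lemma A1_normD u (v : A1 R) : A1_norm (u + v) <= A1_norm u + A1_norm v.
Proof.
apply: disk_norm_le => [|z w]; first by rewrite addr_ge0 ?A1_norm_ge0.
rewrite -[A1val _ z]/(A1val u z + A1val v z) mulmxDr mulrDl.
by apply: le_trans (vnormD _ _) _; rewrite lerD ?A1_norm_ub.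
Qed.

Lemma A1_normM u (v : A1 R) : A1_norm (u * v) <= A1_norm u * A1_norm v.
Proof.
apply: disk_norm_le => [|z w]; first by rewrite mulr_ge0 ?A1_norm_ge0.
rewrite -[A1val _ z]/(A1val u z *m A1val v z) mulmxA.
apply: le_trans (A1_norm_ub _ _ _) _.
have := ler_wpM2l (A1_norm_ge0 v) (A1_norm_ub u z w).
by rewrite mulrA [A1_norm v * A1_norm u]mulrC.
Qed.

Lemma A1_normZ c u : A1_norm (c *: u) = complex.Re `|c| * A1_norm u.
Proof.
have le d w : A1_norm (d *: w) <= normc d * A1_norm w.
  apply: disk_norm_le => [|z v]; first by rewrite mulr_ge0 ?normc_ge0 ?A1_norm_ge0.
  rewrite -[A1val _ z]/(d *: A1val w z) -scalemxAr vnormZ -mulrA.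
  by rewrite ler_wpM2l ?normc_ge0 ?A1_norm_ub.
apply/le_anti/andP; split; [exact: le|have [->|c0] := eqVneq c 0].
  by rewrite normr0 mul0r A1_norm_ge0.
have cp : 0 < normc c.
  by rewrite lt_def normc_ge0 andbT; apply: contra c0 => /eqP/Normc.eq0_normc ->.
rewrite -[complex.Re _]/(normc c) mulrC -ler_pdivlMr// mulrC -Normc.normcV.
by have := le c^-1 (c *: u); rewrite scalerA mulVf// scale1r.
Qed.

Lemma A1_norm_eq0 u : A1_norm u = 0 -> u = 0.
Proof.
move=> u0; apply: A1P => z; apply/matrixP => i j.
have -> : A1val 0 z = 0 by rewrite -[LHS]/(0%:M) raddf0.
rewrite mxE; apply: Normc.eq0_normc; apply/le_anti.
by rewrite normc_ge0 andbT -u0 A1_norm_entry.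
Qed.

Lemma A1_norm_star u : A1_norm (star u * u) = A1_norm u ^+ 2.
Proof.
have half w : A1_norm w ^+ 2 <= A1_norm (w * star w).
  rewrite -[leRHS]sqr_sqrtr ?A1_norm_ge0// ler_sqr ?nnegrE ?sqrtr_ge0 ?A1_norm_ge0//.
  apply: disk_norm_le => [|z v]; first exact: sqrtr_ge0.
  rewrite -ler_sqr ?nnegrE ?mulr_ge0 ?sqrtr_ge0 ?vnorm_ge0// exprMn sqr_sqrtr ?A1_norm_ge0//.
  (* The adjoint moves across the form, and Cauchy-Schwarz then bounds the squared length by the
     norm of [w * star w]. *)
  have -> : vnorm (v *m A1val w z) ^+ 2 = normc (dotmx v (v *m A1val (w * star w) z)).
    rewrite -[A1val (_ * _) z]/(A1val w z *m (A1val w z)^t*).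
    have -> : dotmx v (v *m (A1val w z *m (A1val w z)^t*)) =
              dotmx (v *m A1val w z) (v *m A1val w z).
      by rewrite dotmx_mulmx mulmxA.
    by rewrite -sqr_vnorm normc_real ger0_norm ?sqr_ge0.
  apply: le_trans (dotmx_le _ _) _; rewrite mulrC expr2 mulrA.
  by rewrite ler_wpM2r ?vnorm_ge0 ?A1_norm_ub.
have lestar w : A1_norm w <= A1_norm (star w).
  have := le_trans (half w) (A1_normM w (star w)).
  have [->|w0] := eqVneq (A1_norm w) 0; first by rewrite A1_norm_ge0.
  have wp : 0 < A1_norm w by rewrite lt_def w0 A1_norm_ge0.
  by rewrite expr2 ler_pM2l.
have starE w : A1_norm (star w) = A1_norm w.
  by apply/le_anti; rewrite lestar andbT; have := lestar (star w); rewrite starK.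
apply/le_anti/andP; split.
  by apply: le_trans (A1_normM _ _) _; rewrite starE expr2.
by have := half (star u); rewrite starK starE.
Qed.

Lemma A1_complete (s : nat -> A1 R) :
  (forall e : R, 0 < e -> exists N : nat, forall m n : nat,
      (N <= m)%N -> (N <= n)%N -> A1_norm (s m - s n) < e) ->
  exists l, (fun n => A1_norm (s n - l)) @ \oo --> (0 : R).
Proof.
move=> sC.
have ent n m z i j : A1val (s n - s m) z i j = A1val (s n) z i j - A1val (s m) z i j.
  by rewrite -[A1val _ z]/(A1val (s n) z + -1 *: A1val (s m) z) !mxE mulN1r.
have /choice[L hL] (p : disk * ('I_2 * 'I_2)) : exists l,
    forall e : R, 0 < e -> exists N : nat, forall n : nat,
    (N <= n)%N -> normc (A1val (s n) p.1 p.2.1 p.2.2 - l) < e.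
  apply: complex_complete => e /sC[N hN]; exists N => m n Nm Nn.
  by rewrite -ent; apply: le_lt_trans (A1_norm_entry _ _ _ _) (hN _ _ Nm Nn).
pose l z : M2 := \matrix_(i, j) L (z, (i, j)).
(* The index [N] comes from the norm and depends on [e] alone, so the entrywise limits are uniform
   in [z]. *)
have unif (e : R) : 0 < e -> exists N : nat, forall n, (N <= n)%N ->
    forall z i j, normc (A1val (s n) z i j - l z i j) <= e.
  move=> /sC[N hN]; exists N => n Nn z i j.
  apply/ler_addgt0Pr => d d0; have [N' hN'] := hL (z, (i, j)) d d0.
  have := hN' _ (leq_maxr N N'); have := hN n _ Nn (leq_maxl N N').
  have := A1_norm_entry (s n - s (maxn N N')) z i j; rewrite ent mxE /=.
  have := normcD (A1val (s n) z i j - A1val (s (maxn N N')) z i j)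
    (A1val (s (maxn N N')) z i j - L (z, (i, j))).
  by rewrite addrA subrK; lra.
have lc : continuous l.
  apply/disk_continuousP => z e e0; have e3 : 0 < e / 3 by rewrite divr_gt0.
  have [N /(_ N (leqnn N)) hN] := unif _ e3.
  have [/disk_continuousP sc _] := A1valP (s N); have [d d0 hd] := sc z _ e3.
  exists d => // w /hd wz i j.
  have := normcD (l w i j - A1val (s N) w i j) (A1val (s N) w i j - l z i j).
  have := normcD (A1val (s N) w i j - A1val (s N) z i j) (A1val (s N) z i j - l z i j).
  rewrite !addrA !subrK [normc (l w i j - A1val _ w i j)]normcB.
  by have := wz i j; have := hN z i j; have := hN w i j; lra.
have A1l : A1_set l.
  split=> // t tpi; apply/is_diag_mxP => i j ij.
  apply: Normc.eq0_normc; apply/le_anti; rewrite normc_ge0 andbT.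
  apply/ler_addgt0Pr => e e0; rewrite add0r.
  have e4 : 0 < e / 4 by rewrite divr_gt0.
  have [N /(_ N (leqnn N)) hN] := unif _ e4.
  have [_ /(_ t tpi)/is_diag_mxP/(_ _ _ ij) sd] := A1valP (s N).
  (* The off-diagonal entry vanishes for [s N], so only [l - s N] contributes, and conjugation by a
     unitary does not enlarge it. *)
  have -> : ((twist t)^t* *m l (circle_pt t) *m twist t) i j =
      ((twist t)^t* *m (l (circle_pt t) - A1val (s N) (circle_pt t)) *m twist t) i j.
    by rewrite mulmxBr mulmxBl [RHS]mxE [X in _ = _ + X]mxE sd subr0.
  apply: entry_le => v; rewrite !mulmxA vnorm_unitary; last first.
    exact/unitarymxP/twist_unitary.
  apply: le_trans (@vnorm_mul_le _ _ _ (e / 4) _ _) _.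
    by move=> i' j'; have := hN (circle_pt t) i' j'; rewrite normcB !mxE.
  rewrite vnorm_unitary; last first.
    by rewrite trmxCK -[X in X *m _]mul1mx mulmxKtV// twist_unitary.
  by rewrite ler_wpM2r ?vnorm_ge0//; lra.
exists (A1mk A1l); apply/cvgrPdist_le => e e0.
have e4 : 0 < e / 4 by rewrite divr_gt0.
have [N hN] := unif _ e4; exists N => // n /= /hN nN.
rewrite sub0r normrN ger0_norm ?A1_norm_ge0//.
apply: disk_norm_le => [|z v]; first exact: ltW.
apply: le_trans (@vnorm_mul_le _ _ _ (e / 4) _ _) _.
  move=> i j; apply: le_trans (nN z i j).
  by rewrite -[A1val _ z]/(A1val (s n) z + -1 *: l z) !mxE mulN1r.
by rewrite ler_wpM2r ?vnorm_ge0//; lra.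
Qed.

HB.instance Definition _ := isCStar.Build R (A1 R)
  A1_normD A1_normZ A1_norm_eq0 A1_complete A1_normM A1_norm_star.

End DiskNorm.

(** * Two-by-two matrices by their entries *)

Section Matrix2.
Variable R : realType.
Implicit Types a b c d : R[i].
Local Open Scope sesquilinear_scope.

Definition mx2 a b c d : 'M[R[i]]_2 :=
  \matrix_(i, j) if i == 0 then if j == 0 then a else b else if j == 0 then c else d.

Lemma mx2P (M N : 'M[R[i]]_2) : M 0 0 = N 0 0 -> M 0 1 = N 0 1 ->
  M 1 0 = N 1 0 -> M 1 1 = N 1 1 -> M = N.
Proof.
move=> h1 h2 h3 h4; apply/matrixP => i j.
by case: i j => -[|[|//]] p [[|[|//]] q];
  [move: h1|move: h2|move: h3|move: h4]; congr (M _ _ = N _ _); apply: val_inj.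
Qed.

Lemma mx2_eta (M : 'M[R[i]]_2) : M = mx2 (M 0 0) (M 0 1) (M 1 0) (M 1 1).
Proof. by apply: mx2P; rewrite mxE. Qed.

Lemma mx2D a b c d a' b' c' d' :
  mx2 a b c d + mx2 a' b' c' d' = mx2 (a + a') (b + b') (c + c') (d + d').
Proof. by apply: mx2P; rewrite !mxE. Qed.

Lemma mx2B a b c d a' b' c' d' :
  mx2 a b c d - mx2 a' b' c' d' = mx2 (a - a') (b - b') (c - c') (d - d').
Proof. by apply: mx2P; rewrite !mxE. Qed.

Lemma mx2Z e a b c d : e *: mx2 a b c d = mx2 (e * a) (e * b) (e * c) (e * d).
Proof. by apply: mx2P; rewrite !mxE. Qed.

Lemma mx2M a b c d a' b' c' d' : mx2 a b c d *m mx2 a' b' c' d' =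
  mx2 (a * a' + b * c') (a * b' + b * d') (c * a' + d * c') (c * b' + d * d').
Proof. by apply: mx2P; rewrite !mxE big_ord_recr big_ord1 /= !mxE. Qed.

Lemma mx2_star a b c d : (mx2 a b c d)^t* = mx2 a^* c^* b^* d^*.
Proof. by apply: mx2P; rewrite !mxE. Qed.

Lemma mx2_scalar a : a%:M = mx2 a 0 0 a.
Proof. by apply: mx2P; rewrite !mxE. Qed.

Lemma mx2_continuous (T : topologicalType) (f g h k : T -> R[i]) :
  continuous f -> continuous g -> continuous h -> continuous k ->
  continuous (fun z => mx2 (f z) (g z) (h z) (k z)).
Proof.
move=> fc gc hc kc; apply: mx_continuousP => i j.
rewrite (_ : (fun z => _) = fun z => if i == 0 then if j == 0 then f z else g z
  else if j == 0 then h z else k z).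
  by case: (i == 0); case: (j == 0); [exact: fc|exact: gc|exact: hc|exact: kc].
by apply/funext => z; rewrite mxE.
Qed.

End Matrix2.

(** * The model representation *)

Section Model.
Variable R : realType.
Local Notation disk := (@closed_disk R).
Local Notation M2 := 'M[R[i]]_2.
Implicit Types (z w : disk).
Local Open Scope sesquilinear_scope.

(** The gap between the eigenvalues of [t] in the model, which are [(1 + s) / 2] and
    [(1 - s) / 2]. *)
Definition model_s (x : R) : R := Num.sqrt (1 - x ^+ 2).
Definition model_b (x : R) : R := Num.sqrt ((1 + model_s x) / 2).

Lemma model_s_ge0 x : 0 <= model_s x. Proof. exact: sqrtr_ge0. Qed.

Lemma model_b_gt0 x : 0 < model_b x.
Proof. by rewrite sqrtr_gt0; have := model_s_ge0 x; lra. Qed.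

Lemma sqr_model_b x : model_b x ^+ 2 = (1 + model_s x) / 2.
Proof. by rewrite sqr_sqrtr//; have := model_s_ge0 x; lra. Qed.

Lemma sqr_model_s x : 0 <= x <= 1 -> model_s x ^+ 2 = 1 - x ^+ 2.
Proof. by move=> x01; rewrite sqr_sqrtr//; nra. Qed.

Definition model_beta z : R := model_b (normc (dval z)).
Definition model_alpha z : R[i] := dval z * ((2 * model_beta z)^-1)%:C%C.

Definition model_mx z : M2 := mx2 0 (model_alpha z) (model_beta z)%:C%C 0.

Lemma sqr_model_alpha z :
  normc (model_alpha z) ^+ 2 = (1 - model_s (normc (dval z))) / 2.
Proof.
have b0 := model_b_gt0 (normc (dval z)).
have z01 : 0 <= normc (dval z) <= 1 by rewrite normc_ge0 dvalP.
rewrite Normc.normcM normc_real ger0_norm ?invr_ge0 ?mulr_ge0 ?ltW//.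
rewrite exprMn exprVn exprMn sqr_model_b; have := sqr_model_s z01.
move: (model_s _) (model_s_ge0 (normc (dval z))) => s s0 sE.
have -> : normc (dval z) ^+ 2 = 1 - s ^+ 2 by rewrite sE opprB addrC subrK.
by field; rewrite gt_eqF//; lra.
Qed.

Lemma dval_alpha z : model_alpha z * (model_beta z)%:C%C = 2^-1 * dval z.
Proof.
have b0 := model_b_gt0 (normc (dval z)).
rewrite /model_alpha -mulrA -rmorphM /= mulrC; congr (_ * _).
have -> : (2 * model_beta z)^-1 * model_beta z = 2^-1.
  by rewrite invfM -mulrA mulVf ?mulr1// gt_eqF.
by rewrite fmorphV rmorph_nat.
Qed.

(** [model_b] never vanishes, and the phase of [dval z] enters only through the factor [dval z] of
    one corner. No square root of it is chosen, so the centre of the disk is no exception. *)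
Lemma model_continuous : continuous model_mx.
Proof.
have dvc : continuous (@dval R) by exact: initial_continuous.
have nc z w : `|normc (dval z) - normc (dval w)| <= normc (dval w - dval z).
  rewrite ler_norml.
  have := normcD (dval w) (dval z - dval w); rewrite addrC subrK.
  have := normcD (dval z) (dval w - dval z); rewrite addrC subrK.
  by rewrite [normc (dval z - _)]normcB; lra.
have sc : continuous model_s.
  move=> x; apply: (@continuous_comp _ _ _ (fun x : R => 1 - x ^+ 2) Num.sqrt).
    by apply: cvgB; [exact: cvg_cst|exact: exprn_continuous].
  exact: sqrt_continuous.
have bc : continuous model_b.
  move=> x; apply: (@continuous_comp _ _ _ (fun x : R => (1 + model_s x) / 2) Num.sqrt).
    by apply: cvgM; [apply: cvgD; [exact: cvg_cst|exact: sc]|exact: cvg_cst].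
  exact: sqrt_continuous.
have rc (k : R -> R) : continuous k -> continuous (fun z => (k (normc (dval z)))%:C%C).
  move=> kc z A /complex_nbhsP[e e0 eA].
  have /cvgrPdist_lt/(_ e e0)/nbhs_ballP[d /= d0 hd] := kc (normc (dval z)).
  apply/disk_nbhsP; exists d => // w wz; apply: eA.
  rewrite -rmorphB normc_real distrC; apply: hd.
  by rewrite -ball_normE /ball_ /=; apply: le_lt_trans wz.
have mc (T : topologicalType) (f g : T -> R[i]) :
    continuous f -> continuous g -> continuous (fun x => f x * g x).
  by move=> fc gc x; apply: cvgM; [exact: fc|exact: gc].
have ac : continuous model_alpha.
  apply: mc; first exact: dvc.
  apply: (rc (fun x => (2 * model_b x)^-1)) => x; apply: cvgV.
    by rewrite mulf_neq0 ?pnatr_eq0 ?gt_eqF// model_b_gt0.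
  by apply: cvgM; [exact: cvg_cst|exact: bc].
by apply: mx2_continuous; [exact: cst_continuous|exact: ac|exact: (rc model_b)|exact: cst_continuous].
Qed.

Lemma expi_half (t : R) : expi t = expi (t / 2) * expi (t / 2).
Proof.
rewrite {1}(splitr t) /expi; apply/eqP; rewrite eq_complex /= cosD sinD.
by rewrite eqxx /= mulrC eqxx.
Qed.

Lemma twistE (t : R) : twist t = ((Num.sqrt 2)^-1)%:C%C *:
  mx2 (expi (t / 2)) (- expi (t / 2)) 1 1.
Proof. by congr (_ *: _); apply: mx2P; rewrite !mxE. Qed.

Lemma beta_circle (t : R) : model_beta (circle_pt t) ^+ 2 = 2^-1.
Proof.
have -> : model_beta (circle_pt t) = model_b 1.
  by congr model_b; rewrite -[LHS]/(normc (expi t)) normc_eq1 ?norm_expi.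
by rewrite sqr_model_b /model_s expr1n subrr sqrtr0 addr0 mul1r.
Qed.

Lemma model_circle (t : R) : model_mx (circle_pt t) =
  (model_beta (circle_pt t))%:C%C *: mx2 0 (expi t) 1 0.
Proof.
have b0 : 0 < model_beta (circle_pt t) := model_b_gt0 _.
have bE : (2 * model_beta (circle_pt t))^-1 = model_beta (circle_pt t).
  apply: (mulIf (lt0r_neq0 b0)); rewrite -expr2 beta_circle.
  by rewrite invfM -mulrA mulVf ?mulr1// gt_eqF.
by rewrite mx2Z !mulr0 mulr1 /model_mx /model_alpha bE mulrC.
Qed.

(** The columns of [twist t] are eigenvectors of the model at [circle_pt t], with eigenvalues plus
    and minus [be] times [expi (t / 2)]. *)
Lemma A1_model : A1_set model_mx.
Proof.
split=> [|t _]; first exact: model_continuous.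
have V1 : (twist t)^t* *m twist t = 1%:M.
  by rewrite -[X in X *m _]mul1mx mulmxKtV// twist_unitary.
set be := model_beta (circle_pt t).
set c := expi (t / 2).
have -> : (twist t)^t* *m model_mx (circle_pt t) *m twist t =
    (twist t)^t* *m twist t *m mx2 (be%:C%C * c) 0 0 (- (be%:C%C * c)).
  rewrite -!mulmxA; congr (_ *m _); rewrite model_circle -/be twistE -/c.
  rewrite -!scalemxAl -!scalemxAr !scalerA mulrC !mx2M -!scalerA; congr (_ *: _).
  by rewrite mx2Z expi_half -/c; congr mx2; ring.
rewrite V1 mul1mx; apply/is_diag_mxP => i j.
by case: i j => -[|[|//]] ? [[|[|//]] ?]; rewrite !mxE.
Qed.

Definition model : A1 R := A1mk A1_model.

Lemma model_rel : star model * model + model * star model = 1.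
Proof.
apply: A1P => z.
rewrite -[LHS]/((model_mx z)^t* *m model_mx z + model_mx z *m (model_mx z)^t*).
rewrite mx2_star !mx2M mx2D -[RHS]/(1%:M) mx2_scalar.
have bb : (model_beta z)%:C%C^* = (model_beta z)%:C%C :> R[i] by rewrite /Num.conj /= oppr0.
have e : (model_beta z)%:C%C * (model_beta z)%:C%C + model_alpha z * (model_alpha z)^* = 1.
  rewrite -sqr_normcJ sqr_model_alpha -rmorphM -expr2 sqr_model_b -rmorphD /=.
  by rewrite -mulrDl addrACA subrr addr0 divff ?pnatr_eq0.
by rewrite bb conjC0; congr mx2; rewrite ?mul0r ?mulr0 ?addr0 ?add0r// -e;
  rewrite [_^* * _]mulrC addrC.
Qed.

End Model.

(** * The model norm dominates every C*-seminorm *)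

Section ModelNorm.
Variable R : realType.
Local Notation disk := (@closed_disk R).
Local Notation M2 := 'M[R[i]]_2.
Implicit Types (z w : disk) (p : ncpoly R).
Local Open Scope sesquilinear_scope.

Definition nc_model : ncpoly R -> A1 R := nc_lift (model R).

Lemma nc_model_hom : star_hom nc_model. Proof. exact/nc_lift_hom/model_rel. Qed.

Lemma nc_model_gen : nc_model (nc_gen R) = model R.
Proof. exact: (nc_liftE (model_rel R)). Qed.

Definition at_pt z : A1 R -> M2 := fun u => A1val u z.

Lemma at_pt_hom z : star_hom (at_pt z).
Proof.
by split=> // c u v; apply: mx2P; rewrite !mxE.
Qed.

Lemma horner_mx2 (a d : R[i]) (q : {poly R[i]}) :
  horner_alg (mx2 a 0 0 d : M2) q = mx2 q.[a] 0 0 q.[d].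
Proof.
elim/poly_ind: q => [|f c IH].
  by rewrite rmorph0 !horner0; apply: mx2P; rewrite !mxE.
rewrite !(rmorphD, rmorphM) /= IH horner_algX horner_algC !hornerE.
have -> : c%:A = c%:M :> M2 by rewrite -scalemx1.
rewrite mx2_scalar [X in X + _]mx2M mx2D; congr mx2; rewrite ?mul0r ?mulr0 ?addr0 //.
by rewrite add0r.
Qed.

Lemma model_gram z : (at_pt z) (star (model R) * model R) =
  mx2 (model_beta z ^+ 2)%:C%C 0 0 (normc (model_alpha z) ^+ 2)%:C%C.
Proof.
rewrite -[LHS]/((model_mx z)^t* *m model_mx z) mx2_star mx2M sqr_normcJ.
have bb : (model_beta z)%:C%C^* = (model_beta z)%:C%C :> R[i] by rewrite /Num.conj /= oppr0.
rewrite bb conjC0 !mul0r !mulr0 !addr0 !add0r rmorphXn expr2.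
by congr mx2; rewrite mulrC.
Qed.

(** Every [s] in [0, 1] is an eigenvalue of [t] somewhere on the disk: at modulus [x] the gap is
    [|2 s - 1|], and the sign of [2 s - 1] decides in which diagonal corner [s] sits. *)
Lemma horner_model_ge (q : {poly R[i]}) (s : R) : 0 <= s <= 1 ->
  normc q.[s%:C%C] <= cnorm (horner_alg (star (model R) * model R) q : A1 R).
Proof.
move=> s01; pose x := Num.sqrt (1 - (2 * s - 1) ^+ 2).
have x0 : 0 <= x by exact: sqrtr_ge0.
have x2 : x ^+ 2 = 1 - (2 * s - 1) ^+ 2 by rewrite sqr_sqrtr//; nra.
have x1 : normc (x%:C%C : R[i]) <= 1.
  rewrite normc_real ger0_norm//; have := sqr_ge0 (2 * s - 1).
  by nra.
pose z := disk_of x1.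
have sx : model_s (normc (dval z)) = `|2 * s - 1|.
  by rewrite dvalK normc_real ger0_norm// /model_s x2 subKr sqrtr_sqr.
have g := model_gram z; rewrite sqr_model_b sqr_model_alpha sx in g.
set T := star (model R) * model R in g *.
have h := star_hom_horner T q (at_pt_hom z); rewrite g horner_mx2 in h.
have en i j : normc (at_pt z (horner_alg T q) i j) <= cnorm (horner_alg T q : A1 R).
  exact: A1_norm_entry.
have [s2|s2] := leP 0 (2 * s - 1).
  have := en 0 0; rewrite h mxE /= ger0_norm//.
  by have -> : (1 + (2 * s - 1)) / 2 = s by lra.
have := en 1 1; rewrite h mxE /= ltr0_norm//.
by have -> : (1 - - (2 * s - 1)) / 2 = s by lra.
Qed.

Variables (B : cstarAlgType R) (phi : ncpoly R -> B).
Hypothesis phiH : star_hom phi.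

Lemma homog_bound k d p : homog k d p -> cnorm (phi p) <= cnorm (nc_model p).
Proof.
move=> /star_homogM[q qE].
rewrite -ler_sqr ?nnegrE ?cnorm_ge0// -!cnorm_star.
rewrite -(star_homS phiH) -(star_homS nc_model_hom) -(star_homM phiH) -(star_homM nc_model_hom).
rewrite qE (star_hom_horner _ _ phiH) (star_hom_horner _ _ nc_model_hom).
rewrite (star_homM phiH) (star_homM nc_model_hom) (star_homS phiH) (star_homS nc_model_hom) nc_model_gen.
apply: cnorm_horner_gen; last by move=> s s01; apply: horner_model_ge.
  by rewrite -(star_homS phiH) -!(star_homM phiH) -(star_homD phiH) nc_gen_rel (star_hom1 phiH).
exact: cnorm_ge0.
Qed.

Lemma conj_hom (D : M2) : D *m D^t* = 1%:M -> D^t* *m D = 1%:M ->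
  star_hom (fun X : M2 => D *m X *m D^t*).
Proof.
move=> DD DD'; split.
- by move=> c X Y; rewrite mulmxDr mulmxDl -scalemxAr -scalemxAl.
- by rewrite mulmx1.
- move=> X Y; rewrite -[X * Y]/(X *m Y) -[RHS]/(_ *m _) !mulmxA; congr (_ *m _ *m _).
  by rewrite -[_ *m D]mulmxA DD' mulmx1.
- by move=> X; rewrite /star /= /mxstar !trmx_mul !map_mxM trmxCK mulmxA.
Qed.

Lemma rot_subproof (l : R[i]) z : `|l| = 1 -> normc (l ^+ 2 * dval z) <= 1.
Proof. by move=> l1; rewrite Normc.normcM normcX normc_eq1// expr1n mul1r dvalP. Qed.

Definition rot (l : R[i]) z (l1 : `|l| = 1) : disk := disk_of (rot_subproof z l1).

(* The gauge automorphism a -> l a covers the rotation of the disk by l^2. *)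
Lemma model_rot l z (l1 : `|l| = 1) : model_mx (rot z l1) =
  l *: (mx2 l 0 0 1 *m model_mx z *m (mx2 l 0 0 1)^t*).
Proof.
have nE : normc (dval (rot z l1)) = normc (dval z).
  by rewrite dvalK Normc.normcM normcX normc_eq1// expr1n mul1r.
have bE : model_beta (rot z l1) = model_beta z by rewrite /model_beta nE.
have ll : l * l^* = 1 by rewrite -normCK l1 expr1n.
rewrite mx2_star /model_mx !mx2M mx2Z /model_alpha bE dvalK conjC0 conjC1.
congr mx2; rewrite ?(mul0r, mulr0, add0r, addr0, mulr1, mul1r)//.
  by rewrite expr2 !mulrA.
by rewrite mulrCA ll mulr1.
Qed.

(** The rotation multiplies a component by [l] to the power [k - d], which may be negative; both
    sides are therefore multiplied by [l ^+ d]. *)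
Lemma homog_rot k d l z (l1 : `|l| = 1) p : homog k d p ->
  l ^+ d *: at_pt (rot z l1) (nc_model p) =
  l ^+ k *: (mx2 l 0 0 1 *m at_pt z (nc_model p) *m (mx2 l 0 0 1)^t*).
Proof.
have ll : l * l^* = 1 by rewrite -normCK l1 expr1n.
set D := mx2 l 0 0 1.
have DD : D *m D^t* = 1%:M.
  by rewrite mx2_star mx2M mx2_scalar conjC0 conjC1 !(mul0r, mulr0, addr0, add0r, mulr1) ll.
have cH := conj_hom DD (mulmx1C DD).
set cD := (fun X : M2 => _) in cH.
rewrite -[D *m at_pt _ _ *m _]/(cD _).
have zH := at_pt_hom z; have wH := at_pt_hom (rot z l1).
have aE : at_pt (rot z l1) (nc_model (nc_gen R)) = l *: cD (at_pt z (nc_model (nc_gen R))).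
  by rewrite nc_model_gen; exact: model_rot.
have bE : at_pt (rot z l1) (nc_model (star (nc_gen R))) = l^* *: cD (at_pt z (nc_model (star (nc_gen R)))).
  by rewrite !(star_homS nc_model_hom, star_homS wH, star_homS zH, star_homS cH) aE starZ.
move=> [g ->]; rewrite !(star_homM nc_model_hom, star_homX nc_model_hom) !(star_hom_horner _ _ nc_model_hom).
rewrite !(star_homM wH, star_homX wH, star_homM zH, star_homX zH, star_homM cH, star_homX cH).
rewrite !(star_hom_horner _ _ wH) !(star_hom_horner _ _ zH) !(star_hom_horner _ _ cH).
rewrite !(star_homM nc_model_hom) !(star_homM wH) !(star_homM zH) !(star_homM cH) aE bE.
(* The phases of [a] and of its star cancel in [t], so the polynomial factor is only conjugated. *)
have tE (X Y : M2) : (l^* *: X) * (l *: Y) = X * Y.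
  by rewrite -scalerAl -scalerAr scalerA [_ * l]mulrC ll scale1r.
rewrite tE !exprZn -!scalerAl -!scalerAr -!scalerAl !scalerA; congr (_ *: _).
have [dk|kd] := leqP d k.
  have -> : (d - k = 0)%N by apply/eqP.
  by rewrite [l^* ^+ 0]expr0 mulr1 -exprD subnKC.
have /eqP -> : (k - d == 0)%N by rewrite subn_eq0 ltnW.
by rewrite [l ^+ 0]expr0 mul1r -{1}(subnKC (ltnW kd)) exprD -mulrA -exprMn ll expr1n mulr1.
Qed.

Lemma homog_component d (v : nat -> ncpoly R) k : (forall j, homog j d (v j)) ->
  (k < (2 * d).+1)%N ->
  cnorm (nc_model (v k)) <= cnorm (nc_model (\sum_(j < (2 * d).+1) v j)).
Proof.
move=> hv; set n := (2 * d).+1 => kn; set u := \sum_(j < n) v j.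
have [l [l1 lE]] := root_average R n.
apply: disk_norm_le => [|z x]; first exact: A1_norm_ge0.
have n0 : 0 < n%:R :> R by rewrite ltr0n.
have D1 m : mx2 (l m) 0 0 1 *m (mx2 (l m) 0 0 1)^t* = 1%:M.
  have ll : l m * (l m)^* = 1 by rewrite -normCK l1 expr1n.
  by rewrite mx2_star mx2M mx2_scalar conjC0 conjC1 !(mul0r, mulr0, addr0, add0r, mulr1) ll.
(* [homog_rot] summed over all components: the sum weighted by [l^j] is the value of [u] at a
   rotated point, up to a phase and a unitary conjugation, and these preserve norms. *)
have uE m : \sum_(j < n) l m ^+ j *: at_pt z (nc_model (v j)) =
    l m ^+ d *: ((mx2 (l m) 0 0 1)^t* *m at_pt (rot z (l1 m)) (nc_model u) *m mx2 (l m) 0 0 1).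
  rewrite /u (star_hom_sum nc_model_hom) (star_hom_sum (at_pt_hom _)) mulmx_sumr mulmx_suml.
  rewrite scaler_sumr; apply: eq_bigr => j _.
  rewrite scalemxAl scalemxAr (homog_rot _ _ (hv j)) -scalemxAr -scalemxAl !mulmxA.
  by rewrite (mulmx1C (D1 m)) mul1mx -mulmxA (mulmx1C (D1 m)) mulmx1.
rewrite -[A1val _ z]/(at_pt z (nc_model (v k))).
have := lE _ (fun j => at_pt z (nc_model (v j))) k kn => /= ->.
rewrite -scalemxAr vnormZ Normc.normcV normc_nat mulrC ler_pdivrMr//.
rewrite mulmx_sumr; apply: le_trans (vnorm_sum _ _ _) _.
rewrite mulr_natr -[X in _ *+ X](card_ord n) -sumr_const; apply: ler_sum => m _.
rewrite uE scalerA -scalemxAr vnormZ Normc.normcM Normc.normcV !normcX normc_eq1//.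
rewrite !expr1n invr1 !mul1r !mulmxA vnorm_unitary//.
apply: le_trans (A1_norm_ub _ _ _) _.
by rewrite vnorm_unitary// trmxCK; exact: mulmx1C.
Qed.

Lemma filt_bound d p : filt d p -> cnorm (phi p) <= (2 * d).+1%:R * cnorm (nc_model p).
Proof.
move=> [v hv ->]; rewrite (star_hom_sum phiH); apply: le_trans (cnorm_sum _ _ _) _.
rewrite mulr_natl -[X in _ *+ X](card_ord (2 * d).+1) -sumr_const.
apply: ler_sum => k _; apply: le_trans (homog_bound (hv k)) _.
exact: homog_component.
Qed.

Lemma ncpoly_bound p : cnorm (phi p) <= cnorm (nc_model p).
Proof.
pose q := star p * p; have [m hm] := filt_expr q.
have sq (A : cstarAlgType R) (f : ncpoly R -> A) : star_hom f ->
    cnorm (f q) = cnorm (f p) ^+ 2.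
  by move=> fH; rewrite (star_homM fH) (star_homS fH) cnorm_star.
rewrite -ler_sqr ?nnegrE ?cnorm_ge0// -(sq _ _ phiH) -(sq _ _ nc_model_hom).
have sa (A : cstarAlgType R) (f : ncpoly R -> A) : star_hom f -> star (f q) = f q.
  by move=> fH; rewrite -(star_homS fH) starM starK.
(* Filtration degree [2^n m] costs [2 * 2^n * m + 1], which is at most [(2 m + 1) * 2^n]. *)
apply: (@power_trick _ _ _ (2 * m).+1%:R) => [||n]; rewrite ?cnorm_ge0//.
rewrite -(cnormX_sa _ (sa _ _ phiH)) -(cnormX_sa _ (sa _ _ nc_model_hom)).
rewrite -(star_homX phiH) -(star_homX nc_model_hom).
apply: le_trans (filt_bound (hm _)) _; rewrite ler_wpM2r ?cnorm_ge0// -natrM ler_nat.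
have : (0 < 2 ^ n)%N by rewrite expn_gt0.
by move: (2 ^ n)%N => c; nia.
Qed.

End ModelNorm.

(** * Density of the image *)

Section Density.
Variable R : realType.
Local Notation disk := (@closed_disk R).
Local Notation M2 := 'M[R[i]]_2.
Local Notation NC := (ncpoly R).
Implicit Types (z w : disk) (p q : NC).
Local Open Scope sesquilinear_scope.

Definition ev z p : M2 := at_pt z (nc_model p).

Lemma ev_hom z : star_hom (ev z).
Proof.
have rH := nc_model_hom R; have zH := at_pt_hom z; rewrite /ev; split.
- by move=> c p q; rewrite (star_hom_linear rH) (star_hom_linear zH).
- by rewrite (star_hom1 rH) (star_hom1 zH).
- by move=> p q; rewrite (star_homM rH) (star_homM zH).
- by move=> p; rewrite (star_homS rH) (star_homS zH).
Qed.

Lemma ev_gen z : ev z (nc_gen R) = model_mx z.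
Proof. by rewrite /ev nc_model_gen. Qed.

Lemma expi_surj (c : R[i]) : normc c = 1 -> exists2 t : R, 0 <= t <= 2 * pi & expi t = c.
Proof.
case: c => x y /= xy1.
have xy : x ^+ 2 + y ^+ 2 = 1.
  by rewrite -[LHS]sqr_sqrtr ?xy1 ?expr1n// addr_ge0 ?sqr_ge0.
have x1 : -1 <= x <= 1 by have := sqr_ge0 y; nra.
have [/andP[t0 tpi] ct] := acos_def x1.
have st0 : 0 <= sin (acos x) by apply: sin_ge0_pi; rewrite t0 tpi.
have st : sin (acos x) ^+ 2 = y ^+ 2.
  by have := cos2Dsin2 (acos x); rewrite ct -xy => /addrI.
have [y0|y0] := leP 0 y.
  exists (acos x); first by have := pi_ge0 R; lra.
  rewrite /expi ct; congr Complex; apply/eqP.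
  by rewrite -(@eqrXn2 _ 2)// st.
exists (2 * pi - acos x); first by have := pi_ge0 R; lra.
have -> : 2 * pi - acos x = - acos x + pi + pi by lra.
rewrite /expi !cosDpi !sinDpi !opprK cosN sinN ct; congr Complex.
apply/oppr_inj; rewrite opprK; apply/eqP.
by rewrite -(@eqrXn2 _ 2)// ?oppr_ge0 1?ltW// st sqrrN.
Qed.

(** Inside the disk [t] has distinct eigenvalues and yields the diagonal matrix units, while [a]
    yields the other two. On the circle [t] is scalar, but [a] has two distinct eigenvalues, so
    affine functions of [a] fill the matrices diagonalized by [twist t]. *)
Lemma ev_surj (f : A1 R) z : exists p, ev z p = A1val f z.
Proof.
have zH := ev_hom z.
have [z1|z1] := eqVneq (normc (dval z)) 1.
  have [t tpi tz] := expi_surj z1.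
  have -> : z = circle_pt t by apply: dval_inj.
  have [_ /(_ t tpi)/is_diag_mxP dg] := A1valP f.
  set D := _ *m twist t in dg.
  have U := twist_unitary t; have U1 := unitarymxP U.
  have FE : A1val f (circle_pt t) = twist t *m D *m (twist t)^t*.
    by rewrite /D !mulmxA U1 mul1mx -mulmxA U1 mulmx1.
  have DE : D = mx2 (D 0 0) 0 0 (D 1 1).
    have d01 : D 0 1 = 0 by apply: dg.
    have d10 : D 1 0 = 0 by apply: dg.
    by rewrite [LHS]mx2_eta d01 d10.
  move: (D 0 0) (D 1 1) DE => d1 d2 DE.
  set c := expi (t / 2); have cc : c * c^* = 1 := expi_conj _.
  set be : R[i] := (model_beta (circle_pt t))%:C%C.
  have be0 : be != 0 by rewrite fmorph_eq0 gt_eqF// model_b_gt0.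
  have rr (r : R) : r%:C%C^* = r%:C%C :> R[i] by rewrite /Num.conj /= oppr0.
  have ss : ((Num.sqrt 2)^-1)%:C%C * ((Num.sqrt 2)^-1)%:C%C = 2^-1 :> R[i].
    by rewrite -rmorphM -expr2 exprVn sqr_sqrtr// fmorphV rmorph_nat.
  (* Lagrange interpolation taking the values [d1] and [d2] at the eigenvalues [be * c] and
     [- (be * c)]; the inverse of [c] is its conjugate. *)
  exists (((d1 + d2) / 2) *: 1 + ((d1 - d2) / 2 * c^* / be) *: nc_gen R).
  have zH' := ev_hom (circle_pt t).
  rewrite (star_homD zH') !(star_homZ zH') (star_hom1 zH') ev_gen model_circle.
  have tsE : (twist t)^t* = ((Num.sqrt 2)^-1)%:C%C *: mx2 c^* 1 (- c^*) 1.
    rewrite twistE mx2Z mx2_star mx2Z -/c.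
    by congr mx2; rewrite rmorphM /= rr ?rmorphN ?conjC1.
  rewrite FE DE tsE twistE -/be -/c expi_half -/c scalerA mulfVK//.
  have -> : (1 : M2) = mx2 1 0 0 1 by rewrite -[1]/(1%:M) mx2_scalar.
  rewrite -!scalemxAl -!scalemxAr scalerA ss !mx2M !mx2Z mx2D.
  have e1 : c * d1 * c^* = d1 by rewrite mulrAC cc mul1r.
  have e2 : c * d2 * c^* = d2 by rewrite mulrAC cc mul1r.
  congr mx2; rewrite ?(mulr0, mul0r, addr0, add0r, mulr1, mul1r, mulrN, mulNr, opprK, e1, e2).
  - by rewrite mulrC.
  - have -> : (d1 - d2) / 2 * c^* * (c * c) = (d1 - d2) / 2 * c * (c * c^*) by ring.
    by rewrite cc; ring.
  - by ring.
  - by rewrite mulrC.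
set s := model_s (normc (dval z)).
have s0 : s != 0.
  rewrite gt_eqF// sqrtr_gt0 subr_gt0 exprn_ilt1 ?normc_ge0//.
  by rewrite lt_neqAle z1 dvalP.
set a := nc_gen R.
set ga : R[i] := (normc (model_alpha z) ^+ 2)%:C%C.
have tE : ev z (star a * a) = mx2 (model_beta z ^+ 2)%:C%C 0 0 ga.
  by rewrite /ev (star_homM (nc_model_hom R)) (star_homS (nc_model_hom R)) nc_model_gen model_gram.
have [p0 e0] : exists p0, ev z p0 = mx2 1 0 0 0.
  (* The spectral projection of [t]: the eigenvalue [ga] is subtracted and the gap [s] divided
     out. *)
  exists (s%:C%C^-1 *: (star a * a - ga *: 1)).
  rewrite (star_homZ zH) (star_homB zH) (star_homZ zH) (star_hom1 zH) tE.
  have -> : ga *: (1 : M2) = mx2 ga 0 0 ga by rewrite -mx2_scalar -scalemx1.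
  have bs : (model_beta z ^+ 2)%:C%C + -1 * ga = s%:C%C.
    by rewrite mulN1r -rmorphB sqr_model_b sqr_model_alpha -/s; congr (_%:C%C); lra.
  rewrite -scaleN1r !mx2Z mx2D mx2Z bs mulVf ?fmorph_eq0//.
  by congr mx2; rewrite ?(mulN1r, subrr, mulr0, addr0).
have [p1 e1] : exists p1, ev z p1 = mx2 0 0 0 1.
  exists (1 - p0); rewrite (star_homB zH) (star_hom1 zH) e0 -[1]/(1%:M) mx2_scalar.
  by rewrite -scaleN1r mx2Z mx2D; congr mx2; rewrite ?(mulr1, mulr0, addr0, subrr).
have [p2 e2] : exists p2, ev z p2 = mx2 0 0 1 0.
  exists ((model_beta z)%:C%C^-1 *: (p1 * a)).
  have bn : (model_beta z)%:C%C != 0 :> R[i].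
    by rewrite fmorph_eq0 gt_eqF// model_b_gt0.
  rewrite (star_homZ zH) (star_homM zH) e1 ev_gen -[_ * model_mx z]/(_ *m _).
  rewrite mx2M mx2Z; congr mx2; rewrite ?(mul0r, mulr0, addr0, add0r, mul1r)//.
  by rewrite mulVf.
have e3 : ev z (star p2) = mx2 0 1 0 0.
  by rewrite (star_homS zH) e2 -[star _]/(_^t*) mx2_star !conjC0 conjC1.
have := mx2_eta (A1val f z).
move: (A1val f z 0 0) (A1val f z 0 1) (A1val f z 1 0) (A1val f z 1 1) => m1 m2 m3 m4 ->.
exists (m1 *: p0 + m2 *: star p2 + m3 *: p2 + m4 *: p1).
rewrite !(star_homD zH) !(star_homZ zH) e0 e1 e2 e3 !mx2Z !mx2D.
by congr mx2; rewrite ?(mulr0, mulr1, addr0, add0r).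
Qed.

(** The node [c] ranges over the whole plane because the walk may leave the disk. [K] limits the
    damage away from the node; it and [d] are uniform in [c], so that the number of steps can be
    fixed in advance. *)
Lemma local_approx (f : A1 R) (e : R) : 0 < e -> exists K : R, exists2 d : R, 0 < d &
  forall c : R[i], exists p, cnorm (nc_model p - f) <= K /\
    forall w, normc (dval w - c) < d -> forall i j, normc (ev w p i j - A1val f w i j) <= e.
Proof.
move=> e0.
have entB p w i j : A1val (nc_model p - f) w i j = ev w p i j - A1val f w i j.
  by rewrite -[A1val _ w]/(ev w p + -1 *: A1val f w) !mxE mulN1r.
(* A single index gives both the bound and the radius, which makes [P] monotone as [disk_cover]
   requires. *)
pose P (n : nat) z := exists p, cnorm (nc_model p - f) <= n%:R /\
  forall w, normc (dval w - dval z) < n.+1%:R^-1 ->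
    forall i j, normc (ev w p i j - A1val f w i j) <= e.
have [|z|N hN] := @disk_cover R P.
- move=> m n z mn [p [pm hp]]; exists p; split.
    by apply: le_trans pm _; rewrite ler_nat.
  move=> w wz; apply: hp; apply: lt_le_trans wz _.
  by rewrite lef_pV2 ?posrE// ler_nat.
- have [p pz] := ev_surj f z.
  have [/disk_continuousP/(_ z e e0)[d d0 hd] _] := A1valP (nc_model p - f).
  pose n := Num.truncn (`|cnorm (nc_model p - f)| + 2 / d).
  have nb : `|cnorm (nc_model p - f)| + 2 / d < n.+1%:R by apply: truncnS_gt.
  have d2 : 0 < d / 2 by rewrite divr_gt0.
  exists n.+1, (d / 2) => // z' zz'; exists p; split.
    apply: ltW; apply: le_lt_trans nb; apply: le_trans (ler_norm _) _.
    by rewrite lerDl divr_ge0// ltW.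
  move=> w wz' i j; rewrite -entB.
  have -> : A1val (nc_model p - f) w i j = A1val (nc_model p - f) w i j - A1val (nc_model p - f) z i j.
    by rewrite [A1val _ z i j]entB pz subrr subr0.
  apply/ltW/hd.
  have n2 : n.+2%:R^-1 <= d / 2.
    have h : 2 / d <= n.+2%:R.
      apply: (@le_trans _ _ n.+1%:R); last by rewrite ler_nat.
      by apply: ltW; apply: le_lt_trans nb; rewrite lerDr.
    have -> : d / 2 = (2 / d)^-1 by rewrite invfM invrK mulrC.
    by rewrite lef_pV2 ?posrE ?divr_gt0.
  have := normcD (dval w - dval z') (dval z' - dval z).
  by rewrite addrA subrK; move: wz' n2 zz'; move: n.+2%:R^-1 => r; lra.
exists N%:R; exists (N.+1%:R^-1 / 2); first by rewrite divr_gt0// invr_gt0.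
(* A disk point within half the radius lends its [p] to [c]; without one the closeness condition is
   vacuous, and any [p] that meets the bound will do. *)
move=> c; have [[z zc]|nz] := pselect (exists z, normc (dval z - c) < N.+1%:R^-1 / 2).
  have [p [pK hp]] := hN z; exists p; split=> // w wc; apply: hp.
  have := normcD (dval w - c) (c - dval z).
  by rewrite addrA subrK [normc (c - _)]normcB; move: zc wc; move: N.+1%:R^-1 => r; lra.
have [p [pK hp]] := hN (circle_pt 0); exists p; split=> // w wc.
by case: nz; exists w.
Qed.

End Density.

(** * Approximation by a random walk *)

Section Walk.
Variable R : realType.

(* Mean of g over the n-step walk with steps +-2 in either coordinate, whose expected
   step is (x, y). *)
Fixpoint walk_mean (x y : R) n (g : R -> R -> R) (s t : R) : R :=
  if n is n'.+1 then
    (1 + x) / 4 * walk_mean x y n' g (s + 2) t + (1 - x) / 4 * walk_mean x y n' g (s - 2) t +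
    ((1 + y) / 4 * walk_mean x y n' g s (t + 2) + (1 - y) / 4 * walk_mean x y n' g s (t - 2))
  else g s t.

(** An exact second moment. Each step has squared length 4 and mean [(x, y)], hence variance
    [4 - x^2 - y^2], and functions of this quadratic form are reproduced by one step. *)
Lemma walk_mean_quadratic x y n (e C a b s t : R) :
  walk_mean x y n (fun s t => e + C * ((s - a) ^+ 2 + (t - b) ^+ 2)) s t =
  e + C * (n%:R * (4 - x ^+ 2 - y ^+ 2) +
    ((s + n%:R * x - a) ^+ 2 + (t + n%:R * y - b) ^+ 2)).
Proof.
elim: n s t => [|n IHn] s t /=; first by rewrite !mul0r add0r !addr0.
by rewrite !IHn -natr1; field.
Qed.

Local Notation disk := (@closed_disk R).
Local Notation NC := (ncpoly R).

(* The elements of the *-algebra mapped to the scalar functions Re w and Im w. *)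
Definition nc_re : NC := nc_gen R ^+ 2 + star (nc_gen R ^+ 2).
Definition nc_im : NC := (- 'i%C) *: (nc_gen R ^+ 2 - star (nc_gen R ^+ 2)).

Fixpoint nc_walk n (q : R -> R -> NC) (s t : R) : NC :=
  if n is n'.+1 then
    4^-1 *: ((1 + nc_re) * nc_walk n' q (s + 2) t + (1 - nc_re) * nc_walk n' q (s - 2) t +
    ((1 + nc_im) * nc_walk n' q s (t + 2) + (1 - nc_im) * nc_walk n' q s (t - 2)))
  else q s t.

Lemma ev_sqr (z : disk) : ev z (nc_gen R ^+ 2) = (2^-1 * dval z)%:M.
Proof.
rewrite expr2 (star_homM (ev_hom z)) ev_gen -[_ * _]/(_ *m _) mx2M mx2_scalar.
rewrite dval_alpha; congr mx2; rewrite ?(mul0r, mulr0, addr0, add0r)//.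
by rewrite mulrC dval_alpha.
Qed.

Lemma ev_re (z : disk) : ev z nc_re = (complex.Re (dval z))%:C%C%:M.
Proof.
rewrite (star_homD (ev_hom z)) (star_homS (ev_hom z)) ev_sqr.
rewrite -[star _]/((_^t*)%sesqui) !mx2_scalar mx2_star mx2D conjC0 addr0.
have -> : 2^-1 * dval z + (2^-1 * dval z)^* = (complex.Re (dval z))%:C%C.
  rewrite rmorphM fmorphV rmorph_nat -mulrDr.
  by rewrite -[RHS](mulKf (_ : 2 != 0 :> R[i])) ?pnatr_eq0// -addcJ.
by [].
Qed.

Lemma ev_im (z : disk) : ev z nc_im = (complex.Im (dval z))%:C%C%:M.
Proof.
rewrite (star_homZ (ev_hom z)) (star_homB (ev_hom z)) (star_homS (ev_hom z)) ev_sqr.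
rewrite -[star _]/((_^t*)%sesqui) !mx2_scalar mx2_star conjC0 mx2B mx2Z subrr mulr0.
have -> : - 'i%C * (2^-1 * dval z - (2^-1 * dval z)^*) = (complex.Im (dval z))%:C%C.
  rewrite rmorphM fmorphV rmorph_nat -mulrBr subcJ -[2 * _ * _]mulrA.
  rewrite mulKf ?pnatr_eq0// mulrC -mulrA mulrN -expr2 sqr_i opprK mulr1.
  by [].
by [].
Qed.

(** At [z] the weights become nonnegative scalars with sum 1, so [M] can be subtracted in each
    branch separately and the errors average like the walk. *)
Lemma nc_walk_bound (z : disk) n (q : R -> R -> NC) (M : 'M[R[i]]_2) (g : R -> R -> R) v s t :
  (forall s t, vnorm (v *m (ev z (q s t) - M)) <= g s t) ->
  vnorm (v *m (ev z (nc_walk n q s t) - M)) <=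
    walk_mean (complex.Re (dval z)) (complex.Im (dval z)) n g s t.
Proof.
move=> qg; elim: n s t => [|n IHn] s t //=.
set x := complex.Re (dval z); set y := complex.Im (dval z).
have x1 : `|x| <= 1 := le_trans (normc_Re _) (dvalP z).
have y1 : `|y| <= 1 := le_trans (normc_Im _) (dvalP z).
have zH := ev_hom z.
have wt (c : R) (p : NC) : ev z p = c%:C%C%:M -> forall r,
    ev z ((1 + p) * r) = (1 + c)%:C%C *: ev z r /\ ev z ((1 - p) * r) = (1 - c)%:C%C *: ev z r.
  move=> pc r; rewrite !(star_homM zH) (star_homD zH) (star_homB zH) (star_hom1 zH) pc.
  have e1 : (1 : 'M[R[i]]_2) + c%:C%C%:M = (1 + c)%:C%C%:M by rewrite rmorphD rmorph1 raddfD.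
  have e2 : (1 : 'M[R[i]]_2) - c%:C%C%:M = (1 - c)%:C%C%:M by rewrite rmorphB rmorph1 raddfB.
  by rewrite e1 e2; split; exact: mul_scalar_mx.
rewrite (star_homZ zH) !(star_homD zH).
have [-> _] := wt x _ (ev_re z) (nc_walk n q (s + 2) t).
have [_ ->] := wt x _ (ev_re z) (nc_walk n q (s - 2) t).
have [-> _] := wt y _ (ev_im z) (nc_walk n q s (t + 2)).
have [_ ->] := wt y _ (ev_im z) (nc_walk n q s (t - 2)).
set A := ev z _; set B := ev z _; set C := ev z _; set D := ev z _.
have -> : 4^-1 *: ((1 + x)%:C%C *: A + (1 - x)%:C%C *: B + ((1 + y)%:C%C *: C + (1 - y)%:C%C *: D)) - M =
   ((1 + x) / 4)%:C%C *: (A - M) + ((1 - x) / 4)%:C%C *: (B - M) +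
   (((1 + y) / 4)%:C%C *: (C - M) + ((1 - y) / 4)%:C%C *: (D - M)).
  apply/matrixP => i j; rewrite !mxE !(rmorphM, rmorphD, rmorphN, rmorph1, fmorphV, rmorph_nat) /=.
  by field.
rewrite !mulmxDr -!scalemxAr.
have term (r : R) (X : 'M[R[i]]_2) (b : R) : 0 <= r -> vnorm (v *m (X - M)) <= b ->
    vnorm (r%:C%C *: (v *m (X - M))) <= r * b.
  by move=> r0 h; rewrite vnormZ normc_real ger0_norm// ler_wpM2l.
apply: le_trans (vnormD _ _) _; apply: lerD; apply: le_trans (vnormD _ _) _;
  apply: lerD; apply: term; rewrite ?IHn//; move: x1 y1; rewrite !ler_norml; lra.
Qed.

Lemma nc_model_dense (f : A1 R) (e : R) : 0 < e -> exists p, cnorm (nc_model p - f) <= e.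
Proof.
(* A tolerance [e / 8] on entries is [e / 2] in operator norm; the other half is left for the far
   nodes. *)
move=> e0; have e8 : 0 < e / 8 by rewrite divr_gt0.
have [K [d d0 /choice[q hq]]] := local_approx f e8.
have K0 : 0 <= K by have [h _] := hq 0; exact: le_trans (cnorm_ge0 _) h.
(* Makes the variance term [4 K / (d^2 n)] smaller than [e / 2]. *)
pose n := (Num.truncn (8 * K / (d ^+ 2 * e))).+1.
have nE : 8 * K / (d ^+ 2 * e) < n%:R by exact: truncnS_gt.
have n0 : 0 < n%:R :> R by rewrite ltr0n.
pose Q (s t : R) := q (Complex (s / n%:R) (t / n%:R)).
exists (nc_walk n Q 0 0).
apply: disk_norm_le => [|z v]; first exact: ltW.
set x := complex.Re (dval z); set y := complex.Im (dval z).
have -> : A1val (nc_model (nc_walk n Q 0 0) - f) z = ev z (nc_walk n Q 0 0) - A1val f z.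
  by rewrite -[LHS]/(ev z _ + -1 *: A1val f z) scaleN1r.
(* Chebyshev: at a node farther than [d] from [z], the error [K * vnorm v] is at most [C] times the
   squared distance. Walk positions are [n] times the nodes, hence the factor [n^2]. *)
pose C := K / (d ^+ 2 * n%:R ^+ 2) * vnorm v.
have C0 : 0 <= C by rewrite mulr_ge0 ?vnorm_ge0// divr_ge0// mulr_ge0// exprn_ge0// ltW.
apply: le_trans (nc_walk_bound (g := fun s t =>
  e / 2 * vnorm v + C * ((s - n%:R * x) ^+ 2 + (t - n%:R * y) ^+ 2)) _ _ _ _) _.
  move=> s t; have [qK qd] := hq (Complex (s / n%:R) (t / n%:R)).
  have [near|far] := ltP (normc (dval z - Complex (s / n%:R) (t / n%:R))) d.
    have := @vnorm_mul_le _ _ (ev z (Q s t) - A1val f z) (e / 8) v.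
    have h i j : normc ((ev z (Q s t) - A1val f z) i j) <= e / 8.
      by have := qd z near i j; rewrite !mxE.
    move=> /(_ h) /le_trans; apply.
    have -> : 2%:R * 2%:R * (e / 8) = e / 2 by field.
    by rewrite lerDl mulr_ge0// addr_ge0 ?sqr_ge0.
  have := A1_norm_ub (nc_model (Q s t) - f) z v.
  have -> : A1val (nc_model (Q s t) - f) z = ev z (Q s t) - A1val f z.
    by rewrite -[LHS]/(ev z _ + -1 *: A1val f z) scaleN1r.
  move=> /le_trans; apply.
  apply: (@le_trans _ _ (K * vnorm v)); first by rewrite ler_wpM2r ?vnorm_ge0.
  have -> : K * vnorm v = C * (d ^+ 2 * n%:R ^+ 2).
    by rewrite /C; field; rewrite !gt_eqF.
  apply: (@le_trans _ _ (C * ((s - n%:R * x) ^+ 2 + (t - n%:R * y) ^+ 2))); last first.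
    by rewrite lerDr mulr_ge0 ?vnorm_ge0// divr_ge0// ltW.
  rewrite ler_wpM2l//.
  have -> : (s - n%:R * x) ^+ 2 + (t - n%:R * y) ^+ 2 =
      normc (dval z - Complex (s / n%:R) (t / n%:R)) ^+ 2 * n%:R ^+ 2.
    rewrite sqr_normcE /x /y; case: (dval z) => x' y' /=.
    by field; rewrite gt_eqF.
  by rewrite ler_wpM2r ?sqr_ge0// ler_sqr ?nnegrE ?normc_ge0// ltW.
rewrite walk_mean_quadratic !add0r !subrr expr0n addr0.
apply: (@le_trans _ _ (e / 2 * vnorm v + C * (n%:R * 4))).
  rewrite lerD2l ler_wpM2l// addr0 ler_wpM2l ?(ltW n0)//.
  by rewrite -addrA -opprD gerBl addr_ge0 ?sqr_ge0.
have -> : C * (n%:R * 4) = 4 * K / (d ^+ 2 * n%:R) * vnorm v.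
  by rewrite /C; field; rewrite !gt_eqF.
rewrite -mulrDl ler_wpM2r ?vnorm_ge0// -lerBrDl ler_pdivrMr; last first.
  by rewrite mulr_gt0// exprn_gt0.
move: nE; rewrite ltr_pdivrMr; last by rewrite mulr_gt0// exprn_gt0.
move=> nE; have -> : (e - e / 2) * (d ^+ 2 * n%:R) = n%:R * (d ^+ 2 * e) / 2 by field.
by lra.
Qed.

End Walk.

(** * The universal property *)

Section Extension.
Variables (R : realType) (B : cstarAlgType R) (phi : ncpoly R -> B).
Hypothesis phiH : star_hom phi.
Implicit Types (f g : A1 R) (l m : B) (p q : ncpoly R).
Let rH := nc_model_hom R.

(** The closure of the graph formed by the pairs [nc_model p], [phi p]. As a relation it needs no
    choice of preimages; [ncpoly_bound] makes it single-valued and density makes it total. *)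
Definition extends_to f l := forall e : R, 0 < e ->
  exists p, cnorm (nc_model p - f) <= e /\ cnorm (phi p - l) <= e.

(** Leaves room for a constant, and [e <= 1] allows the quadratic error of a product to be absorbed
    into a linear one. *)
Lemma extends_to_scaled f l (K : R) : (forall e : R, 0 < e <= 1 ->
    exists p, cnorm (nc_model p - f) <= K * e /\ cnorm (phi p - l) <= K * e) ->
  extends_to f l.
Proof.
move=> h e e0; have K1 : 0 < `|K| + 1 by rewrite ltr_wpDl.
pose d := Num.min 1 (e / (`|K| + 1)).
have d0 : 0 < d by rewrite lt_min ltr01 divr_gt0.
have d1 : d <= 1 by rewrite ge_min lexx.
have de : d * (`|K| + 1) <= e by rewrite -ler_pdivlMr// ge_min lexx orbT.
have [|p [h1 h2]] := h d; first by rewrite d0.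
have Kd : K * d <= e.
  by have := ler_wpM2r (ltW d0) (ler_norm K); lra.
by exists p; split; [apply: le_trans h1 _|apply: le_trans h2 _].
Qed.

Lemma extends_to_dist f g l m : extends_to f l -> extends_to g m ->
  cnorm (l - m) <= cnorm (f - g).
Proof.
move=> hf hg; apply/ler_addgt0Pr => e e0; have e4 : 0 < e / 4 by rewrite divr_gt0.
have [p [p1 p2]] := hf _ e4; have [q [q1 q2]] := hg _ e4.
have := cnorm_triangle (phi p) l m; have := cnorm_triangle (phi q) (phi p) m.
have := cnorm_triangle f (nc_model p) (nc_model q); have := cnorm_triangle g f (nc_model q).
have := ncpoly_bound phiH (p - q); rewrite (star_homB phiH) (star_homB rH).
by rewrite [cnorm (l - phi p)]cnormBC [cnorm (g - nc_model q)]cnormBC; lra.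
Qed.

Lemma extends_to_uniq f l m : extends_to f l -> extends_to f m -> l = m.
Proof.
move=> hl hm; apply/eqP; rewrite -subr_eq0; apply/eqP/cnorm_eq0/le_anti.
rewrite cnorm_ge0 andbT; apply: le_trans (extends_to_dist hl hm) _.
by rewrite subrr cnorm0.
Qed.

Lemma extends_to_model p : extends_to (nc_model p) (phi p).
Proof. by move=> e e0; exists p; rewrite !subrr !cnorm0; split; exact: ltW. Qed.

Lemma extends_to_exists f : exists l, extends_to f l.
Proof.
have dn n : exists p, cnorm (nc_model p - f) <= n.+1%:R^-1.
  by apply: nc_model_dense; rewrite invr_gt0.
have [p hp] := choice dn.
have small (e : R) : 0 < e -> exists N : nat, forall n, (N <= n)%N ->
    cnorm (nc_model (p n) - f) <= e.
  move=> e0; exists (Num.truncn e^-1) => n Nn; apply: le_trans (hp n) _.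
  rewrite -[e]invrK lef_pV2 ?posrE ?invr_gt0//.
  by apply: ltW; apply: lt_le_trans (truncnS_gt _) _; rewrite ler_nat ltnS.
have [|l hl] := @cstar_complete _ _ (fun n => phi (p n)).
  move=> e e0; have [N hN] := small (e / 3) (divr_gt0 e0 (ltr0Sn _ 2)).
  exists N => m n Nm Nn; rewrite -(star_homB phiH).
  apply: le_lt_trans (ncpoly_bound phiH _) _; rewrite (star_homB rH).
  have := cnorm_triangle f (nc_model (p m)) (nc_model (p n)).
  by rewrite [cnorm (f - _)]cnormBC; have := hN m Nm; have := hN n Nn; lra.
exists l => e e0; have [N hN] := small e e0; have [N' hN'] := hl e e0.
exists (p (maxn N N')); split; first by apply/hN/leq_maxl.
by apply/ltW/hN'/leq_maxr.
Qed.

Lemma extends_to_linear (c : R[i]) f g l m : extends_to f l -> extends_to g m ->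
  extends_to (c *: f + g) (c *: l + m).
Proof.
move=> hf hg; apply: (@extends_to_scaled _ _ (normc c + 1)) => e /andP[e0 _].
have [p [p1 p2]] := hf e e0; have [q [q1 q2]] := hg e e0.
exists (c *: p + q); rewrite !(star_homD rH, star_homZ rH, star_homD phiH, star_homZ phiH).
have lin (A : cstarAlgType R) (x y x' y' : A) : cnorm (x - x') <= e -> cnorm (y - y') <= e ->
    cnorm (c *: x + y - (c *: x' + y')) <= (normc c + 1) * e.
  move=> h1 h2; rewrite opprD addrACA -scalerBr; apply: le_trans (cnormD _ _) _.
  by rewrite cnormZc mulrDl mul1r lerD// ler_wpM2l// normc_ge0.
by split; apply: lin.
Qed.

Lemma extends_to_mul f g l m : extends_to f l -> extends_to g m ->
  extends_to (f * g) (l * m).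
Proof.
move=> hf hg.
apply: (@extends_to_scaled _ _ (cnorm f + cnorm g + cnorm l + cnorm m + 1)) => e /andP[e0 e1].
have [p [p1 p2]] := hf e e0; have [q [q1 q2]] := hg e e0.
exists (p * q); rewrite (star_homM rH) (star_homM phiH).
have prod (A : cstarAlgType R) (x y x' y' : A) : cnorm (x - x') <= e -> cnorm (y - y') <= e ->
    cnorm (x * y - x' * y') <= (cnorm x' + cnorm y' + 1) * e.
  move=> h1 h2; have := cnorm_triangle (x * y') (x * y) (x' * y').
  rewrite -mulrBr -mulrBl; have := cnormM x (y - y'); have := cnormM (x - x') y'.
  have hx : cnorm x <= cnorm x' + e.
    by have := cnormD x' (x - x'); rewrite addrC subrK; lra.
  have := ler_wpM2r (cnorm_ge0 y') h1.
  have := ler_pM (cnorm_ge0 x) (cnorm_ge0 (y - y')) hx h2.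
  by have := ler_wpM2l (ltW e0) e1; nra.
have [f0 g0 l0 m0] : [/\ 0 <= cnorm f, 0 <= cnorm g, 0 <= cnorm l & 0 <= cnorm m].
  by split; exact: cnorm_ge0.
split; [apply: le_trans (prod _ _ _ _ _ p1 q1) _|apply: le_trans (prod _ _ _ _ _ p2 q2) _];
  by rewrite ler_wpM2r ?(ltW e0)//; lra.
Qed.

Lemma extends_to_star f l : extends_to f l -> extends_to (star f) (star l).
Proof.
move=> hf e e0; have [p [p1 p2]] := hf e e0; exists (star p).
by rewrite (star_homS rH) (star_homS phiH) -!starB !cnormS.
Qed.

Lemma extension : exists! psi : A1 R -> B, star_hom psi /\ psi \o @nc_model R = phi.
Proof.
have [psi hpsi] := choice extends_to_exists.
have psiE f l : extends_to f l -> psi f = l by exact: extends_to_uniq.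
exists psi; split.
  split; last by apply/funext => p; apply/psiE/extends_to_model.
  split.
  - by move=> c f g; apply/psiE/extends_to_linear.
  - by apply: psiE; rewrite -(star_hom1 rH) -(star_hom1 phiH); exact: extends_to_model.
  - by move=> f g; apply/psiE/extends_to_mul.
  - by move=> f; apply/psiE/extends_to_star.
move=> psi' [psiH' psiE']; apply/funext => f; apply: psiE.
(* A competing [psi'] is automatically continuous by [star_hom_le], the source of the 2, so its
   values lie on the closed graph too. *)
apply: (@extends_to_scaled _ _ 2) => e /andP[e0 _].
have [p pf] := nc_model_dense f e0; exists p.
have -> : phi p = psi' (nc_model p) by rewrite -psiE'.
rewrite -(star_homB psiH'); split; first by lra.
by have := star_hom_le (nc_model p - f) psiH'; lra.
Qed.

End Extension.

(** The first half keeps the second from being vacuous. *)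
Theorem theorem2p2 (R : realType) :
  (exists (D : cstarAlgType R) (rho : ncpoly R -> D), enveloping_cstar rho) /\
  (forall (D : cstarAlgType R) (rho : ncpoly R -> D),
     enveloping_cstar rho -> star_isomorphic D (A1 R)).
Proof.
have env : enveloping_cstar (@nc_model R).
  by split=> [|B phi phiH]; [exact: nc_model_hom|exact: extension].
split; first by exists (A1 R), (@nc_model R).
move=> D rho' [rho'H univ].
have comp (X Y Z : cstarAlgType R) (f : X -> Y) (g : Y -> Z) :
    star_hom f -> star_hom g -> star_hom (g \o f).
  move=> fH gH; split.
  - by move=> c x y; rewrite /= (star_hom_linear fH) (star_hom_linear gH).
  - by rewrite /= (star_hom1 fH) (star_hom1 gH).
  - by move=> x y; rewrite /= (star_homM fH) (star_homM gH).
  - by move=> x; rewrite /= (star_homS fH) (star_homS gH).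
have idH (X : cstarAlgType R) : star_hom (@id X) by split.
have [psi [[psiH psiE] _]] := univ _ _ (nc_model_hom R).
have [chi [[chiH chiE] _]] := env.2 _ _ rho'H.
exists psi => //; exists chi.
(* Both [chi \o psi] and [id] factor [rho'] through itself, and such a factorization is unique; the
   other composite is treated alike. *)
- have [k [_ kU]] := univ _ _ rho'H.
  move=> x; rewrite -[LHS]/((chi \o psi) x) -[RHS]/(id x); congr (_ x).
  rewrite -(kU id) //; symmetry; apply: kU; split; first exact: comp.
  by rewrite -compA psiE chiE.
- have [k [_ kU]] := env.2 _ _ (nc_model_hom R).
  move=> x; rewrite -[LHS]/((psi \o chi) x) -[RHS]/(id x); congr (_ x).
  rewrite -(kU id) //; symmetry; apply: kU; split; first exact: comp.
  by rewrite -compA chiE psiE.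
Qed.
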